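(* Let $\epsilon > 0$. There exists $\delta = \delta(\epsilon) > 0$ such that the following holds. Let $a, F \in \mathbb{F}_q[T]$ be coprime with $\deg F = r$. Then for any positive integers $n$ and $m$ satisfying $$n \geq r\epsilon \quad\text{and}\quad m \geq r(1/4 + \epsilon),$$ and any sequences of complex weights $\boldsymbol{\alpha} = (\alpha_{x_1})_{\deg x_1 < m}$, $\boldsymbol{\beta} = (\beta_{x_2})_{\deg x_2 < n}$ with $\|\boldsymbol{\alpha}\|_\infty, \|\boldsymbol{\beta}\|_\infty < q^{o(r)}$, we have $$\sum_{\substack{\deg x_1 < m \\ (x_1, F) = 1}}\ \sum_{\substack{\deg x_2 < n \\ (x_2, F) = 1}}\alpha_{x_1}\beta_{x_2}\, e_F(a\overline{x_1x_2}) \ll_{\epsilon} q^{m+n-r\delta}.$$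
   Context: $q = p^\ell$ is a fixed odd prime power ($p$ prime) and $\mathbb{F}_q$ is the finite field of order $q$; $F$ is an arbitrary (nonzero) polynomial in $\mathbb{F}_q[T]$, not assumed irreducible or square-free. Sums over $\deg x < n$ run over all polynomials $x\in\mathbb{F}_q[T]$ of degree less than $n$ (not necessarily monic), and $(x,F)$ denotes the gcd. On the field $\mathbb{F}_q(T)_\infty$ of Laurent series $\sum_{i=-\infty}^{N} a_i T^i$ in $1/T$ over $\mathbb{F}_q$, define the additive character $e\left(\sum_{i\le N} a_iT^i\right) = \exp\left(\frac{2\pi i}{p}\mathrm{Tr}(a_{-1})\right)$, where $\mathrm{Tr}:\mathbb{F}_q\to\mathbb{F}_p$ is the absolute trace, and set $e_F(x) = e(x/F)$, which depends only on $x$ modulo $F$. For $x$ coprime to $F$, $\overline{x}$ denotes the inverse of $x$ modulo $F$. $\|\cdot\|_\infty$ is the maximum modulus of the weights. The condition $\|\cdot\|_\infty<q^{o(r)}$ means: there is a fixed function $\eta$ with $\eta(r)/r \to 0$ as $r\to\infty$ such that all weights are bounded by $q^{\eta(r)}$. $A\ll_\epsilon B$ means $|A|\le C B$ with $C$ depending only on $\epsilon$ (and on the fixed $q$ and the fixed function $\eta$). *)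

(* Defs.v *)
From mathcomp Require Import all_boot all_order all_algebra all_fingroup all_field.
From mathcomp Require Import complex.
From mathcomp Require Import all_classical all_reals all_analysis.

Set Implicit Arguments.
Unset Strict Implicit.
Unset Printing Implicit Defensive.

Import Order.TTheory GRing.Theory Num.Theory.
Local Open Scope ring_scope.

(* The elements \sum_(i <= N) a_i T^i of the field of Laurent series in 1/T, each
   given by its coefficient family i |-> a_i. *)
Record laurent (K : nzRingType) := Laurent {
  lcoef : int -> K;
  lcoef_bounded : exists N : int, forall i : int, N < i -> lcoef i = 0 }.

Section LaurentQuotient.
Variable K : fieldType.
Implicit Types (x F P : {poly K}) (L : laurent K).

Definition poly_lcoef x (k : int) : K := if k is Posz n then x`_n else 0.

(* The k-th coefficient of the product P * L in the field of Laurent series. *)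
Definition lcoef_mul P L (k : int) : K :=
  \sum_(i < size P) P`_i * lcoef L (k - i%:Z).

(* The coefficients of the Laurent expansion of x / F: the one of T^n (n >= 0)
   is read off the quotient of x by F, the one of T^-(n+1) is the constant
   coefficient of the polynomial part of T^(n+1) x / F.  See [lfracP]. *)
Definition lfrac_coef x F (k : int) : K :=
  match k with
  | Posz n => (x %/ F)`_n
  | Negz n => ((x * 'X^(n.+1)) %/ F)`_0
  end.

Lemma lfrac_bounded x F :
  exists N : int, forall i : int, N < i -> lfrac_coef x F i = 0.
Proof.
exists (size x)%:Z => -[n|n] //= sx_n; rewrite nth_default //.
by apply: leq_trans (leq_divp _ _) _; apply: ltnW.
Qed.

Definition lfrac x F : laurent K := Laurent (lfrac_bounded x F).

Lemma coef_divp_shift x F i : F != 0 ->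
  ((x * 'X) %/ F)`_i.+1 = (x %/ F)`_i.
Proof.
move=> F0; rewrite {1}(divp_eq x F) mulrDl mulrAC divpD mulpK // coefD coefMX /=.
rewrite [X in _ + X]nth_default ?addr0 // size_divp //.
have [->|R0] := eqVneq (x %% F) 0; first by rewrite mul0r size_poly0.
rewrite size_mulX // leq_subLR addnS ltnS.
by rewrite (leq_trans _ (leq_addr _ _)) // -ltnS prednK ?size_poly_gt0 // ltn_modp.
Qed.

Lemma lfrac_coefE x F (k : int) (N M : nat) : F != 0 -> k + N%:Z = M%:Z ->
  lfrac_coef x F k = ((x * 'X^N) %/ F)`_M.
Proof.
move=> F0; have shift y n i : ((y * 'X^n) %/ F)`_(i + n) = (y %/ F)`_i.
  elim: n y => [|n IHn] y; first by rewrite mulr1 addn0.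
  by rewrite exprSr mulrA addnS coef_divp_shift.
case: k => n kN /=.
  by have -> : M = (n + N)%N by apply/eqP; rewrite -eqz_nat -kN PoszD.
have -> : N = (n.+1 + M)%N.
  by apply/eqP; rewrite -eqz_nat PoszD -kN NegzE addrA subrr add0r.
by rewrite exprD mulrA -[in RHS](add0n M) shift.
Qed.

(* F * (x / F) = x in the field of Laurent series. *)
Lemma lfracP x F : F != 0 -> lcoef_mul F (lfrac x F) =1 poly_lcoef x.
Proof.
move=> F0 k; rewrite /lcoef_mul /=.
have [N [M [kNM sFM]]] : exists N M : nat, k + N%:Z = M%:Z /\ (size F <= M)%N.
  case: k => n; first by exists (size F), (n + size F)%N; rewrite leq_addl.
  by exists (size F + n.+1)%N, (size F); rewrite PoszD NegzE addrC addrK.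
transitivity ((x * 'X^N)`_M).
  rewrite [in RHS](divp_eq (x * 'X^N) F) coefD [X in _ + X]nth_default; last first.
    by rewrite (leq_trans _ sFM) // ltnW // ltn_modp.
  rewrite addr0 [_ %/ _ * _]mulrC coefM.
  rewrite (big_ord_widen M.+1 (fun i => F`_i * lfrac_coef x F (k - i%:Z)));
    last exact: leqW.
  rewrite big_mkcond /=; apply: eq_bigr => i _.
  have leiM : (i <= M)%N by rewrite -ltnS.
  case: ltnP => [_|sFi]; last by rewrite [F`__]nth_default ?mul0r.
  rewrite (@lfrac_coefE _ _ _ N (M - i)) //.
  by rewrite addrAC kNM -subzn.
rewrite coefMXn; case: k kNM => n kNM /=.
  have -> : M = (n + N)%N by apply/eqP; rewrite -eqz_nat -kNM PoszD.
  by rewrite ltnNge leq_addl addnK.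
have -> : N = (n.+1 + M)%N.
  by apply/eqP; rewrite -eqz_nat PoszD -kNM NegzE addrA subrr add0r.
by rewrite ltnS leq_addl.
Qed.

End LaurentQuotient.

Section AdditiveCharacter.
Variables (R : realType) (p : nat) (Fq : finFieldType).
Variable pcharFq : p \in [pchar Fq].
Local Notation L := (pPrimeCharType pcharFq).

(* The trace of Fq over its prime field lies in the line 1%VS spanned by 1; its
   coordinate on 1 is the corresponding element of 'F_p. *)
Definition abs_trace (c : Fq) : 'F_p :=
  coord [tuple (1 : L)] 0 (galTrace 1 {: L} (c : L)).

Lemma abs_traceP (c : Fq) : (abs_trace c)%:R = galTrace 1 {: L} (c : L).
Proof.
have : galTrace 1 {: L} (c : L) \in <<[tuple (1%R : L)]>>%VS.
  rewrite span_seq1; apply: mem_galTrace; last exact: memvf.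
  exact/finField_galois/sub1v.
move/coord_span; rewrite big_ord1 /= => ->.
by rewrite [RHS]mulr_natl.
Qed.

Definition echar (y : laurent Fq) : R[i] :=
  let theta := 2 * pi / p%:R * (abs_trace (lcoef y (-1)))%:R in
  (cos theta +i* sin theta)%C.

Definition echar_mod (F x : {poly Fq}) : R[i] := echar (lfrac x F).

End AdditiveCharacter.

(* The inverse of x modulo F, represented in degree < deg F (0 if there is
   none). *)
Definition inv_mod (Fq : finFieldType) (F x : {poly Fq}) : {poly Fq} :=
  if [pick y : {poly_(size F).-1 Fq} | (x * y) %% F == 1 %% F] is Some y
  then y : {poly Fq} else 0.

Lemma inv_modP (Fq : finFieldType) (F x : {poly Fq}) :
  F != 0 -> coprimep x F -> (x * inv_mod F x) %% F = 1 %% F.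
Proof.
move=> F0 /Bezout_eq1_coprimepP[[u v] /= uv1]; rewrite /inv_mod.
case: pickP => [y /eqP //|no_inv].
have su : (u %% F)%R \is a poly_of_size (size F).-1.
  by rewrite qualifE /= -ltnS prednK ?size_poly_gt0 // ltn_modp.
have /eqP[] := no_inv (NPoly su).
by rewrite /= modp_mul -uv1 modpD modp_mull addr0 mulrC.
Qed.

Definition sup_norm (R : realType) (I : finType) (w : I -> R[i]) : R :=
  \big[Num.max/0]_(i : I) ComplexField.Normc.normc (w i).

(* Main.v *)
(* By Hölder's inequality in each variable and orthogonality of the additive characters
   modulo F, the bilinear sum S satisfies, for all k and l,
     |S| <= ||alpha|| ||beta|| q^(m+n)
            (q^r E_k(n) q^(-2kn) E_l(m) q^(-2lm))^(1/(2kl)),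
   where E_k(n) counts the solutions of
     1/x_1 + ... + 1/x_k = 1/y_1 + ... + 1/y_k  (mod F),  deg x_i, deg y_i < n.
   Clearing denominators gives A D - C B = F y with B = x_1 ... x_k, D = y_1 ... y_k.
   If y = 0, every prime factor of B D occurs at least twice, so B D divides a cube a^3
   with a^2 | B D, and the divisor bound leaves q^(kn + o(r)) solutions.  If y <> 0, then
   D is determined by y modulo B / gcd(A, B), and gcd(A, B) divides y.  Hence
     E_k(n) <= q^(o(r)) (q^(kn) + q^((3k-1)n - r)),
   which is at most q^(2kn - r/2 + o(r)) for the least k with kn >= r/2.
   For x1 a saving strictly beyond q^(r/2) is needed.  When m > r, take l = 1.  When
   m <= r, take l = 2: approximating 1/x_1 + 1/x_2 by z/t modulo F with small t and z, the
   congruence becomes (z y_1 - t)(z y_2 - t) = t^2 + z F w with few possible w, whence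
     E_2(m) <= q^(o(r)) (q^(2m) + q^((7m-r)/2)). *)

Require Import Defs.
From mathcomp Require Import all_boot all_order all_algebra all_fingroup all_field.
From mathcomp Require Import complex.
From mathcomp Require Import all_classical all_reals all_analysis.
From mathcomp Require Import zify ring lra.

Set Implicit Arguments.
Unset Strict Implicit.
Unset Printing Implicit Defensive.

Import Order.TTheory GRing.Theory Num.Theory.
Import numFieldNormedType.Exports.
Local Open Scope ring_scope.

(** * Counting and divisors of polynomials *)

(** Double counting along a relation [r] rather than a map: a witness [y], typically a quotient or a
    divisor, only has to exist for each [x] and is never chosen by a function. *)
Lemma card_le_sum_fiber (T U : finType) (A : {pred T}) (B : {pred U})
    (r : T -> U -> bool) (c : U -> nat) :
  (forall x, x \in A -> exists2 y, y \in B & r x y) ->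
  (forall y, y \in B -> (#|[pred x in A | r x y]| <= c y)%N) ->
  (#|A| <= \sum_(y in B) c y)%N.
Proof.
move=> cover fiber; rewrite -sum1_card.
apply: (@leq_trans (\sum_(x in A) \sum_(y in B) r x y)%N).
  apply: leq_sum => x /cover[y yB rxy].
  by rewrite (bigD1 y) //= rxy.
rewrite exchange_big /=; apply: leq_sum => y yB.
apply: leq_trans (fiber y yB); rewrite -sum1_card big_mkcondr /=.
by apply: leq_sum => x _; case: (r x y).
Qed.

Lemma card_le_fiber (T U : finType) (A : {pred T}) (B : {pred U})
    (r : T -> U -> bool) (c : nat) :
  (forall x, x \in A -> exists2 y, y \in B & r x y) ->
  (forall y, y \in B -> (#|[pred x in A | r x y]| <= c)%N) ->
  (#|A| <= #|B| * c)%N.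
Proof.
by move=> cover fiber; rewrite -sum_nat_const; apply: card_le_sum_fiber cover _.
Qed.

Lemma card_le_inj (T U : finType) (A : {pred T}) (B : {pred U})
    (r : T -> U -> bool) :
  (forall x, x \in A -> exists2 y, y \in B & r x y) ->
  (forall x x' y, x \in A -> x' \in A -> r x y -> r x' y -> x = x') ->
  (#|A| <= #|B|)%N.
Proof.
move=> cover inj; rewrite -[leqRHS]muln1; apply: card_le_fiber cover _ => y _.
apply/card_le1_eqP => x x' /andP[/= xA rx] /andP[/= xA' rx'].
by apply: inj rx' rx.
Qed.

Lemma card_pairs (T U : finType) (P : T -> U -> bool) :
  #|[pred p : T * U | P p.1 p.2]| = (\sum_x #|[pred y | P x y]|)%N.
Proof.
rewrite -sum1_card -(pair_big_dep xpredT P (fun _ _ => 1%N)) /=.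
by apply: eq_bigr => x _; rewrite -sum1_card.
Qed.

Lemma leq_expl (m n e : nat) : (m <= n)%N -> (m ^ e <= n ^ e)%N.
Proof. by case: e => // e; rewrite leq_exp2r. Qed.

Section PolyDivisors.
Variable K : finFieldType.
Implicit Types P X Y d a b F : {poly K}.
Local Notation q := #|K|.

(** Associate divisors count separately, so no normalisation to monic polynomials is ever needed.
    For nonzero [X] the restriction to size at most [size X] loses no divisor. *)
Definition ndiv X := #|[pred d : {poly_(size X) K} | polyn d %| X]|.

Lemma q_gt1 : (1 < q)%N.
Proof. exact: finNzRing_gt1. Qed.

Lemma size_gt0 X : X != 0 -> (0 < size X)%N.
Proof. by rewrite size_poly_gt0. Qed.

Lemma sizeM X Y : X != 0 -> Y != 0 -> (size (X * Y)).+1 = (size X + size Y)%N.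
Proof.
move=> X0 Y0; rewrite size_mul // prednK //.
by rewrite addn_gt0 size_gt0.
Qed.

Lemma size_dvd d X : X != 0 -> d %| X -> (size d <= size X)%N.
Proof. exact: dvdp_leq. Qed.

Lemma dvdp_factor d X : d %| X -> exists Y : {poly K}, X = d * Y.
Proof. by move=> dX; exists (X %/ d); rewrite mulrC divpK. Qed.

Lemma card_dvd_tuples (T I : finType) (A : {pred T}) (z : T -> I -> {poly K}) Y :
  Y != 0 ->
  {in A &, forall t t', z t =1 z t' -> t = t'} ->
  (forall t i, t \in A -> z t i %| Y) ->
  (#|A| <= ndiv Y ^ #|I|)%N.
Proof.
move=> Y0 inj dvd; rewrite -card_ffun_on.
apply: (card_le_inj (r := fun t (f : {ffun I -> {poly_(size Y) K}}) =>
  [forall i, polyn (f i) == z t i])).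
  move=> t tA; exists [ffun i => npolyp (size Y) (z t i)].
    apply/ffun_onP => i; rewrite ffunE inE npolypK ?dvd //.
    by apply: size_dvd => //; apply: dvd.
  by apply/forallP => i; rewrite ffunE npolypK ?eqxx //; apply: size_dvd => //; apply: dvd.
move=> t t' f tA tA' /forallP ft /forallP ft'; apply: inj => // i.
by rewrite -(eqP (ft i)) (eqP (ft' i)).
Qed.

Lemma card_dvd_inj (T : finType) (A : {pred T}) (f : T -> {poly K}) Y :
  Y != 0 -> {in A &, injective f} -> (forall t, t \in A -> f t %| Y) ->
  (#|A| <= ndiv Y)%N.
Proof.
move=> Y0 inj dvd; rewrite -[leqRHS]expn1 -card_unit.
apply: (@card_dvd_tuples _ _ A (fun t _ => f t)) => // [t t' tA tA' ftt'|t _].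
  by apply: inj => //; apply: (ftt' tt).
exact: dvd.
Qed.

Lemma ndiv_gt0 X : X != 0 -> (0 < ndiv X)%N.
Proof.
move=> X0; apply/card_gt0P; exists (npolyp (size X) 1).
by rewrite inE npolypK ?dvd1p // size_poly1 size_poly_gt0.
Qed.

Lemma dvdp_irr_exp P e Y d : irreducible_poly P -> d %| P ^+ e * Y ->
  exists i : 'I_e.+1, exists2 d' : {poly K}, d = P ^+ i * d' & d' %| Y.
Proof.
move=> irrP; have P0 := irredp_neq0 irrP.
elim: e d => [|e IHe] d; first by rewrite expr0 mul1r => dY; exists ord0, d; rewrite ?mul1r.
have [Pd|nPd] := boolP (P %| d); rewrite exprS -mulrA.
  rewrite -(divpK Pd) mulrC dvdp_mul2l // => /IHe[i [d' -> d'Y]].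
  by exists (lift ord0 i), d'; rewrite //= exprS mulrA.
rewrite Gauss_dvdpr; last by rewrite coprimep_sym irreducible_poly_coprime.
by move=> /IHe[i [d' -> d'Y]]; exists (widen_ord (leqnSn _) i), d'.
Qed.

Lemma ndiv_mul_exp P e Y : irreducible_poly P -> Y != 0 ->
  (ndiv (P ^+ e * Y) <= e.+1 * ndiv Y)%N.
Proof.
move=> irrP Y0; have P0 := irredp_neq0 irrP.
have -> : (e.+1 * ndiv Y)%N =
    #|[predX 'I_e.+1 & [pred d : {poly_(size Y) K} | polyn d %| Y]]|.
  by rewrite cardX card_ord.
rewrite /ndiv; apply: (card_le_inj (r := fun (d : {poly_(size (P ^+ e * Y)) K})
    (u : 'I_e.+1 * {poly_(size Y) K}) =>
  polyn d == P ^+ u.1 * polyn u.2)).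
  move=> d; rewrite inE => /(dvdp_irr_exp irrP)[i [d' dE d'Y]].
  exists (i, npolyp (size Y) d'); rewrite ?inE /= npolypK ?dE //; exact: size_dvd.
by move=> d d' u _ _ /eqP dE /eqP d'E; apply/val_inj; rewrite /= dE d'E.
Qed.

Lemma irreducible_dvd X : (1 < size X)%N -> exists2 P : {poly K}, irreducible_poly P & P %| X.
Proof.
have [s] := ubnP (size X); elim: s X => // s IHs X; rewrite ltnS => sXs sX.
have [/irreducibleP irrX|] := boolP (irreducibleb X); first by exists X.
rewrite /irreducibleb sX /= => /forallPn[d]; rewrite negb_imply -ltnNge => /andP[dX sd].
have sdX : (size (polyn d) < size X)%N.
  by apply: leq_ltn_trans (size_npoly d) _; rewrite ltn_predL ltnW.
have [|P irrP Pd] := IHs d _ sd; first exact: leq_trans sdX sXs.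
exists P => //; apply: dvdp_trans Pd _.
by rewrite Pdiv.Idomain.dvdpE.
Qed.

Lemma multiplicity P X : (1 < size P)%N -> X != 0 ->
  exists e (Y : {poly K}), [/\ X = P ^+ e * Y, (e < size X)%N & ~~ (P %| Y)].
Proof.
move=> sP; have [s] := ubnP (size X); elim: s X => // s IHs X; rewrite ltnS => sXs X0.
have P0 : P != 0 by rewrite -size_poly_gt0 ltnW.
have [PX|] := boolP (P %| X); last by exists 0%N, X; rewrite mul1r size_poly_gt0.
have [Y XE] := dvdp_factor PX.
have Y0 : Y != 0 by apply: contraNneq X0 => Y0; rewrite XE Y0 mulr0.
have sX : (size Y < size X)%N by have := sizeM P0 Y0; rewrite -XE; lia.
have [|//|e [Z [YE e_lt nPZ]]] := IHs Y; first exact: leq_trans sX sXs.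
exists e.+1, Z; split=> //; first by rewrite exprS -mulrA -YE XE.
exact: leq_ltn_trans e_lt sX.
Qed.

(** Removing one irreducible [P] completely costs a factor e + 1, where e is its multiplicity, and e
    + 1 is at most [size X]. *)
Lemma ndiv_sieve (S : seq {poly K}) X : X != 0 -> {in S, forall P : {poly K}, irreducible_poly P} ->
  exists Y : {poly K}, [/\ Y %| X, {in S, forall P, ~~ (P %| Y)}
    & (ndiv X <= size X ^ size S * ndiv Y)%N].
Proof.
elim: S X => [|P S IHS] X X0 irrS; first by exists X; rewrite expn0 mul1n.
have irrP : irreducible_poly P by apply: irrS; rewrite mem_head.
have sP : (1 < size P)%N by case: irrP.
have [e [Y [XE eX nPY]]] := multiplicity sP X0.
have Y0 : Y != 0 by apply: contraNneq nPY => ->; rewrite dvdp0.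
have [|Z [ZY nS le]] := IHS Y Y0; first by move=> P' P'S; apply: irrS; rewrite inE P'S orbT.
have YX : Y %| X by rewrite XE dvdp_mull.
exists Z; split; first exact: dvdp_trans ZY YX.
  move=> P'; rewrite inE => /predU1P[->|/nS//].
  by apply: contra nPY => PZ; apply: dvdp_trans PZ ZY.
rewrite {1}XE; apply: leq_trans (ndiv_mul_exp _ irrP Y0) _.
rewrite expnS -mulnA leq_mul //; apply: leq_trans le _.
by rewrite leq_mul // leq_expl // size_dvd.
Qed.

(** Each irreducible factor has degree at least [L], so there are at most deg X / L of them, and
    peeling one off at most halves the number of divisors. The factor q accounts for the constants
    that remain. Taking [L]-th powers keeps the bound in the natural numbers. *)
Lemma ndiv_rough L X : X != 0 ->
  (forall P : {poly K}, irreducible_poly P -> P %| X -> (L < size P)%N) ->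
  (ndiv X ^ L <= q ^ L * 2 ^ size X)%N.
Proof.
have [s] := ubnP (size X); elim: s X => // s IHs X; rewrite ltnS => sXs X0 rough.
have [sX|sX] := leqP (size X) 1.
  apply: (@leq_trans (q ^ L)); last by rewrite leq_pmulr // expn_gt0.
  rewrite leq_expl //; apply: leq_trans (max_card _) _.
  by rewrite card_npoly -[leqRHS]expn1 leq_exp2l ?q_gt1.
have [P irrP PX] := irreducible_dvd sX; have P0 := irredp_neq0 irrP.
have [Y XE] := dvdp_factor PX.
have Y0 : Y != 0 by apply: contraNneq X0 => Y0; rewrite XE Y0 mulr0.
have sPL := rough P irrP PX.
have sXE : (size X).+1 = (size P + size Y)%N by rewrite [in LHS]XE sizeM.
have sYX : (size Y + L <= size X)%N by lia.
have sP : (1 < size P)%N by case: irrP.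
have leY : (ndiv Y ^ L <= q ^ L * 2 ^ size Y)%N.
  apply: IHs => //; first by apply: leq_trans sXs; have [] := irrP; lia.
  by move=> P' irrP' P'Y; apply: rough => //; rewrite XE dvdp_mull.
rewrite {1}XE -[P]expr1; apply: (@leq_trans ((2 * ndiv Y) ^ L)).
  by rewrite leq_expl // ndiv_mul_exp.
rewrite expnMn mulnC (leq_trans (leq_mul leY (leqnn _))) // -mulnA leq_mul2l -expnD.
by rewrite leq_exp2l // sYX orbT.
Qed.

(** The irreducibles of size at most [L] number at most q^L and are sieved out; [D] is the number of
    divisors of the rough part that is left. *)
Lemma ndiv_le L X : X != 0 ->
  exists2 D, (ndiv X <= size X ^ (q ^ L) * D)%N & (D ^ L <= q ^ L * 2 ^ size X)%N.
Proof.
move=> X0; pose S := [seq polyn d | d : {poly_L K} <- enum {: {poly_L K}} & irreducibleb (polyn d)].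
have [|Y [YX nS le]] := @ndiv_sieve S X X0.
  by move=> _ /mapP[P + ->]; rewrite mem_filter => /andP[/irreducibleP].
have sX : (0 < size X)%N by rewrite size_poly_gt0.
have Y0 : Y != 0 by apply: contraNneq X0 => Y0; rewrite -dvd0p -Y0.
exists (ndiv Y).
  apply: leq_trans le _; rewrite leq_mul // leq_pexp2l //.
  by rewrite size_map (leq_trans (size_subseq (filter_subseq _ _))) // -cardE card_npoly.
apply: leq_trans (_ : q ^ L * 2 ^ size Y <= _)%N; last first.
  by rewrite leq_mul // leq_exp2l // size_dvd.
apply: ndiv_rough => // P irrP PY; rewrite ltnNge; apply/negP => sP.
suff /nS/negP[] : P \in S by []; apply/mapP; exists (npolyp L P); last by rewrite npolypK.
by rewrite mem_filter mem_enum andbT npolypK //; apply/irreducibleP.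
Qed.

Definition squarefull X := forall P : {poly K}, irreducible_poly P -> P %| X -> P ^+ 2 %| X.

(** A prime power P^e exactly dividing [X] contributes P^(floor(e/2)) to [a], which works because 2
    floor(e/2) <= e <= 3 floor(e/2) as soon as e >= 2. *)
Lemma squarefull_dvd X : X != 0 -> squarefull X ->
  exists a : {poly K}, a ^+ 2 %| X /\ X %| a ^+ 3.
Proof.
have [s] := ubnP (size X); elim: s X => // s IHs X; rewrite ltnS => sXs X0 sqX.
have [sX|sX] := leqP (size X) 1.
  exists 1; rewrite !expr1n dvd1p; split=> //.
  by rewrite dvdp1 eqn_leq sX size_gt0.
have [P irrP PX] := irreducible_dvd sX; have P0 := irredp_neq0 irrP.
have sP : (1 < size P)%N by case: irrP.
have [e [Y [XE _ nPY]]] := multiplicity sP X0.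
have coPY : coprimep P Y by rewrite irreducible_poly_coprime.
have Y0 : Y != 0 by apply: contraNneq nPY => ->; rewrite dvdp0.
have e2 : (2 <= e)%N.
  have := sqX P irrP PX; rewrite XE; case: e {XE} => [|[|e]] //.
    by rewrite mul1r => P2Y; rewrite (dvdp_trans _ P2Y) // expr2 dvdp_mulIl in nPY.
  by rewrite expr1 expr2 dvdp_mul2l // (negPf nPY).
have sYX : (size Y < size X)%N.
  have Pe0 : P ^+ e != 0 by rewrite expf_neq0.
  have /(size_dvd Pe0) : P %| P ^+ e by rewrite -(subnK e2) exprD dvdp_mull // dvdp_mulIl.
  by have := sizeM Pe0 Y0; rewrite -XE; lia.
have [||a [a2Y Ya3]] := IHs Y _ Y0; first exact: leq_trans sYX sXs.
  move=> P' irrP' P'Y; have P'X : P' %| X by rewrite XE dvdp_mull.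
  have := sqX P' irrP' P'X; rewrite XE Gauss_dvdpr // coprimep_expl // coprimep_expr //.
  rewrite irreducible_poly_coprime //; apply/negP => P'P.
  have P'1 : size P' != 1%N by case: irrP' => /gtn_eqF->.
  by move: P'Y; rewrite (eqp_dvdl _ (apply_irredp irrP P'1 P'P)) (negPf nPY).
have half_e : (e./2.*2 <= e <= 3 * e./2)%N by lia.
exists (P ^+ e./2 * a); rewrite !exprMn -!exprM XE; split; apply: dvdp_mul => //.
  by apply: dvdp_exp2l; lia.
by apply: dvdp_exp2l; lia.
Qed.

End PolyDivisors.

(** * Congruences between sums of reciprocals *)

Section RecipSums.
Variable K : finFieldType.
Implicit Types P X Y d a b F : {poly K}.
Local Notation q := #|K|.

Lemma size_prod_le (I : finType) (P : pred I) (x : I -> {poly K}) n :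
  (forall i, size (x i) <= n.+1)%N ->
  (size (\prod_(i | P i) x i)%R <= (#|P| * n).+1)%N.
Proof.
move=> sx; rewrite -sum1_card big_distrl /=.
elim/big_rec2: _ => [|i c y _ IH]; first by rewrite size_poly1.
apply: leq_trans (size_polyMleq _ _) _; move: (sx i) IH.
by move: (size (x i)) (size y) => a b; lia.
Qed.

Lemma irreducible_dvd_prod (I : finType) P (x : I -> {poly K}) :
  irreducible_poly P -> P %| \prod_i x i -> exists i, P %| x i.
Proof.
move=> irrP PX; apply/existsP; apply: contraLR PX => /existsPn nPx.
rewrite -irreducible_poly_coprime //; apply: (big_ind (coprimep P)) => [|y z|i _].
- exact: coprimep1.
- by rewrite coprimepMr => -> ->.
- by rewrite irreducible_poly_coprime.
Qed.

Definition recip_den (I : finType) (x : I -> {poly K}) := \prod_i x i.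

(** With [recip_den], this is the unreduced fraction for the sum of the 1 / x_i over the product of
    all x_i. *)
Definition recip_num (I : finType) (x : I -> {poly K}) :=
  \sum_i \prod_(j | j != i) x j.

Lemma dvd_recip_den (I : finType) (x : I -> {poly K}) i : x i %| recip_den x.
Proof. by rewrite /recip_den (bigD1 i) //= dvdp_mulIl. Qed.

Lemma recip_den_neq0 (I : finType) (x : I -> {poly K}) :
  (forall i, x i != 0) -> recip_den x != 0.
Proof. by move=> x0; apply/prodf_neq0 => i _. Qed.

Lemma recip_num_dvd (I : finType) (x : I -> {poly K}) i :
  x i %| recip_num x - \prod_(j | j != i) x j.
Proof.
rewrite /recip_num (bigD1 i) //= addrAC subrr add0r.
apply: (big_ind (fun y : {poly K} => x i %| y)) => [|y z|j ji]; first exact: dvdp0.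
  exact: dvdp_add.
by rewrite (bigD1 i) 1?eq_sym //= dvdp_mulIl.
Qed.

Lemma size_recip_den k n (x : 'I_k -> {poly K}) :
  (forall i, size (x i) <= n.+1)%N -> (size (recip_den x) <= (k * n).+1)%N.
Proof. by move=> /(size_prod_le predT); rewrite cardT size_enum_ord. Qed.

Lemma size_recip_num k n (x : 'I_k -> {poly K}) :
  (forall i, size (x i) <= n.+1)%N -> (size (recip_num x) <= (k.-1 * n).+1)%N.
Proof.
move=> sx; apply: leq_trans (size_sum _ _ _) _; apply/bigmax_leqP => i _.
apply: leq_trans (size_prod_le _ sx) _.
by rewrite (eq_card (B := predC1 i)) // cardC1 card_ord.
Qed.

(** Let [P] divide x_i. Modulo [P] the numerator of [x] is the product of the other x_j, and the
    hypothesis makes numerator times [recip_den y] vanish modulo [P]. Hence [P] divides the product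
    of the other x_j times [recip_den y], which gives the second factor [P]. *)
Lemma squarefull_recip_eq (I J : finType) (x : I -> {poly K}) (y : J -> {poly K}) :
  recip_num x * recip_den y = recip_num y * recip_den x ->
  squarefull (recip_den x * recip_den y).
Proof.
have half (I' J' : finType) (x' : I' -> {poly K}) (y' : J' -> {poly K}) P i :
    recip_num x' * recip_den y' = recip_num y' * recip_den x' ->
    P %| x' i -> P ^+ 2 %| recip_den x' * recip_den y'.
  move=> eqxy Px; have denE : recip_den x' = x' i * \prod_(j | j != i) x' j.
    by rewrite /recip_den (bigD1 i).
  rewrite expr2 denE -mulrA dvdp_mul //.
  have -> : \prod_(j | j != i) x' j * recip_den y' =
      recip_num y' * recip_den x'
      - (recip_num x' - \prod_(j | j != i) x' j) * recip_den y'.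
    by rewrite mulrBl eqxy opprB addrCA subrr addr0.
  apply: dvdp_sub; first by rewrite denE dvdp_mull // dvdp_mulr.
  by rewrite dvdp_mulr // (dvdp_trans Px) ?recip_num_dvd.
move=> eqxy P irrP; have [Px _|nPx] := boolP (P %| recip_den x).
  by have [i Pxi] := irreducible_dvd_prod irrP Px; apply: half Pxi.
rewrite Gauss_dvdpr ?irreducible_poly_coprime // => Py.
have [i Pyi] := irreducible_dvd_prod irrP Py.
by rewrite mulrC; apply: half Pyi.
Qed.

Lemma card_le_cover2 (T : finType) (A B C : {pred T}) :
  (forall x, x \in A -> (x \in B) || (x \in C)) -> (#|A| <= #|B| + #|C|)%N.
Proof.
move=> AB; rewrite -cardUI (leq_trans _ (leq_addr _ _)) //.
by apply: subset_leq_card; apply/fintype.subsetP => x /AB; rewrite !inE.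
Qed.

Definition npol (I : finType) n (x : {ffun I -> {poly_n K}}) (i : I) : {poly K} :=
  polyn (x i).

(** * Congruences with k reciprocals on each side *)

Section RecipEnergy.
Variables (k n s tau : nat).
Hypothesis ndiv_tau : forall X, X != 0 -> (size X <= s)%N -> (ndiv X <= tau)%N.
Hypothesis s_large : (3 * (k * n) < s)%N.
Local Notation T := {ffun 'I_k -> {poly_(n.+1) K}}.

Lemma size_recip_den_ffun (x : T) : (size (recip_den (npol x)) <= (k * n).+1)%N.
Proof. by apply: size_recip_den => i; apply: size_npoly. Qed.

(** The product of all 2k polynomials, of degree at most 2kn, is squarefull. So it is a multiple of
    some a^2 and a divisor of a^3, where a has degree at most kn. Once a is fixed, each of the 2k
    polynomials is one of at most [tau] divisors of a^3. *)
Lemma card_recip_eq :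
  (#|[pred p : T * T | [&& [forall i, npol p.1 i != 0%R],
       [forall i, npol p.2 i != 0%R] &
       (recip_num (npol p.1) * recip_den (npol p.2)
         == recip_num (npol p.2) * recip_den (npol p.1))%R]]|
   <= q ^ (k * n).+1 * tau ^ (k + k))%N.
Proof.
pose X (p : T * T) := recip_den (npol p.1) * recip_den (npol p.2).
apply: (@leq_trans (#|[pred a : {poly_((k * n).+1) K} | polyn a != 0]|
                      * tau ^ (k + k))); last first.
  by rewrite leq_mul2r -card_npoly max_card orbT.
apply: (card_le_fiber (r := fun p (a : {poly_((k * n).+1) K}) =>
  (polyn a ^+ 2 %| X p) && (X p %| polyn a ^+ 3))).
  move=> p /and3P[/= /forallP x0 /forallP y0 /eqP eqxy].
  have X0 : X p != 0 by rewrite mulf_neq0 ?recip_den_neq0.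
  have [a [a2X Xa3]] := squarefull_dvd X0 (squarefull_recip_eq eqxy).
  have a0 : a != 0.
    by apply: contraTneq a2X => ->; rewrite expr0n dvd0p.
  have sa : (size a <= (k * n).+1)%N.
    have : (size (a * a)%R <= size (X p))%N by apply: size_dvd => //; rewrite -expr2.
    have := sizeM a0 a0; have := size_gt0 a0.
    have : (size (X p)).+1 = (size (recip_den (npol p.1)) + size (recip_den (npol p.2)))%N.
      by apply: sizeM; apply: recip_den_neq0.
    by have := size_recip_den_ffun p.1; have := size_recip_den_ffun p.2; lia.
  by exists (npolyp _ a); rewrite ?inE npolypK // a2X.
move=> a; rewrite inE => a0; have a30 : polyn a ^+ 3 != 0 by rewrite expf_neq0.
have le_tau : (ndiv (polyn a ^+ 3) <= tau)%N.
  apply: ndiv_tau => //; apply: leq_trans (size_poly_exp_leq _ _) _.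
  by have := size_npoly a; move: (size (polyn a)) => sa; lia.
apply: leq_trans (leq_expl _ le_tau).
have -> : (k + k)%N = #|{: 'I_k + 'I_k}| by rewrite card_sum card_ord.
pose z (p : T * T) i := match i with inl i => npol p.1 i | inr i => npol p.2 i end.
apply: (@card_dvd_tuples _ _ _ _ z) => //.
  move=> [x y] [x' y'] _ _ eqz; congr (_, _); apply/ffunP => i; apply/val_inj.
    exact: (eqz (inl i)).
  exact: (eqz (inr i)).
move=> p i /andP[_ /andP[_ Xa3]]; apply: dvdp_trans Xa3.
by case: i => i; [apply: dvdp_mulr | apply: dvdp_mull]; apply: dvd_recip_den.
Qed.

(* The congruence reads [A D - C B = F g y] with [g = gcd A B].  Given [y], this
   fixes [D] modulo [B / g], and the number of [y] compensates the [q ^ deg g]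
   choices for [D]. *)
Lemma card_recip_cong_neq F (x : T) :
  recip_den (npol x) != 0 -> coprimep (recip_den (npol x)) F -> F != 0 ->
  (#|[pred y : T | [&& [forall i, npol y i != 0%R],
       (size (recip_den (npol y)) <= size (recip_den (npol x)))%N,
       (F %| recip_num (npol x) * recip_den (npol y) -
            recip_num (npol y) * recip_den (npol x))%R &
       (recip_num (npol x) * recip_den (npol y)
         != recip_num (npol y) * recip_den (npol x))%R]]| * q ^ (size F).-1
   <= q ^ (k.-1 * n + k * n).+2 * tau ^ k)%N.
Proof.
set A : {poly K} := recip_num (npol x).
set B : {poly K} := recip_den (npol x) => B0 coBF F0.
set S := [pred y | _].
have [g0 [a [b [AE BE coab]]]] : gcdp A B != 0 /\ exists a b : {poly K},
    [/\ A = gcdp A B * a, B = gcdp A B * b & coprimep b a].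
  have g0 : gcdp A B != 0 by rewrite gcdp_eq0 negb_and B0 orbT.
  split=> //; exists (A %/ gcdp A B), (B %/ gcdp A B).
  split; first by rewrite mulrC divpK ?dvdp_gcdl.
    by rewrite mulrC divpK ?dvdp_gcdr.
  by rewrite coprimep_sym coprimep_div_gcd // B0 orbT.
set g : {poly K} := gcdp A B in g0 AE BE.
have coFg : coprimep F g.
  by rewrite coprimep_sym; apply: coprimep_dvdr coBF; apply: dvdp_gcdr.
have b0 : b != 0 by apply: contraNneq B0 => b0; rewrite BE b0 mulr0.
have ex y : y \in S -> exists2 h : {poly K},
    A * recip_den (npol y) - recip_num (npol y) * B = F * (g * h) & h != 0.
  move=> /and4P[_ _ FE neqE].
  have /dvdp_factor[h EE] : F * g %|
      A * recip_den (npol y) - recip_num (npol y) * B.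
    rewrite Gauss_dvdp // FE; apply: dvdp_sub.
      by rewrite dvdp_mulr ?dvdp_gcdl.
    by rewrite dvdp_mull ?dvdp_gcdr.
  exists h; first by rewrite EE mulrA.
  by apply: contraNneq neqE => h0; rewrite -subr_eq0 EE h0 mulr0.
have size_h y h : y \in S -> h != 0 ->
    A * recip_den (npol y) - recip_num (npol y) * B = F * (g * h) ->
    (size F + size g + size h <= (k.-1 * n + k * n) + 3)%N.
  move=> _ h0 EE.
  have : (size (F * (g * h))%R <= (k.-1 * n + k * n).+1)%N.
    rewrite -EE; apply: leq_trans (size_polyD _ _) _; rewrite size_polyN geq_max.
    have sz (u v : T) :
        (size (recip_num (npol u) * recip_den (npol v))%R <= (k.-1 * n + k * n).+1)%N.
      apply: leq_trans (size_polyMleq _ _) _.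
      have : (size (recip_num (npol u)) <= (k.-1 * n).+1)%N.
        by apply: size_recip_num => i; apply: size_npoly.
      have := size_recip_den_ffun v.
      move: (size (recip_num _)) (size (recip_den _)) => c d; lia.
    by rewrite !sz.
  have gh0 : g * h != 0 by rewrite mulf_neq0.
  have := sizeM F0 gh0; have := sizeM g0 h0.
  by move: (size_gt0 g0) (size_gt0 h0) (size_gt0 F0); clear; lia.
have [/card0_eq S0|] := posnP #|S|; first by rewrite (eq_card0 S0).
case/card_gt0P => y0 y0S.
(* One existing solution shows that the truncated subtraction in [u], the bound for the size of [h],
   is exact. Without any solution the claim is trivial. *)
have sFg : (size F + size g <= (k.-1 * n + k * n).+2)%N.
  have [h hE h0] := ex y0 y0S; have := size_h _ _ y0S h0 hE.
  by move: (size_gt0 h0); clear; lia.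
set u := ((k.-1 * n + k * n) + 3 - size F - size g)%N.
have -> : (q ^ (k.-1 * n + k * n).+2 = q ^ u * q ^ size g * q ^ (size F).-1)%N.
  rewrite -!expnD; congr (_ ^ _)%N.
  by move: (size_gt0 F0) sFg; rewrite /u; clear; lia.
rewrite mulnAC leq_mul2r -mulnA; apply/orP; right.
rewrite -[(q ^ u)%N]card_npoly; apply: (card_le_fiber (r := fun y (h : {poly_u K}) =>
  A * recip_den (npol y) - recip_num (npol y) * B == F * (g * polyn h))).
  move=> y yS; have [h hE h0] := ex y yS; exists (npolyp u h) => //.
  by rewrite npolypK ?hE //; move: (size_h _ _ yS h0 hE); rewrite /u; clear; lia.
move=> h _; set Sh := [pred y in S | _].
have [/card0_eq S0|] := posnP #|Sh|; first by rewrite (eq_card0 S0).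
case/card_gt0P => y1 /andP[y1S /eqP y1E].
rewrite -[(q ^ size g)%N]card_npoly; apply: (card_le_fiber (r := fun y (d : {poly_(size g) K}) =>
  recip_den (npol y) == recip_den (npol y1) + b * polyn d)).
  move=> y /andP[yS /eqP yE].
  (* Subtracting the equations of two solutions with the same [h] and cancelling g leaves a (D - D1)
     = (C - C1) b, where a and b are coprime. *)
  have /dvdp_factor[d dE] : b %| recip_den (npol y) - recip_den (npol y1).
    rewrite -(Gauss_dvdpr _ coab); apply/dvdpP.
    exists (recip_num (npol y) - recip_num (npol y1)); apply: (mulfI g0).
    rewrite mulrA -AE mulrCA -BE; apply/eqP; rewrite -subr_eq0 -/A -/B.
    transitivity (0 == 0 :> {poly K}); last by rewrite eqxx.
    congr (_ == _); rewrite -[RHS](subrr (F * (g * polyn h))) -{1}yE -y1E; ring.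
  (* Here the assumption that the denominator of [y] is no larger than [B] = g b enters: it leaves
     only q^(size g) values for [d]. *)
  have sd : (size d <= size g)%N.
    have [->|d0] := eqVneq d 0; first by rewrite size_poly0.
    have : (size (b * d)%R <= size B)%N.
      rewrite -dE; apply: leq_trans (size_polyD _ _) _; rewrite size_polyN geq_max.
      by case/and4P: yS => _ -> _ _; case/and4P: y1S => _ -> _ _.
    by move: (sizeM b0 d0) (sizeM g0 b0) (size_gt0 b0); rewrite -BE; clear; lia.
  by exists (npolyp (size g) d); rewrite // npolypK // -dE addrC subrK.
move=> d _; set D := _ + b * _.
have [D0|D0] := eqVneq D 0.
  rewrite eq_card0 // => y; rewrite inE; apply/negP => /andP[/andP[/and4P[/forallP y00 _ _ _] _]].
  by rewrite D0 (negPf (recip_den_neq0 _)).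
set SD := [pred y in _ | _].
have [/card0_eq S0|] := posnP #|SD|; first by rewrite (eq_card0 S0).
case/card_gt0P => y2 /andP[_ /eqP y2E].
have le_tau : (ndiv D <= tau)%N.
  apply: ndiv_tau => //; rewrite -y2E (leq_trans (size_recip_den_ffun _)) //.
  by move: s_large; clear; lia.
apply: leq_trans (leq_expl _ le_tau); rewrite -[X in (_ ^ X)%N]card_ord.
apply: (@card_dvd_tuples _ _ _ _ (fun y : T => npol y)) => // [y y' _ _ eqy|y i /andP[_ /eqP <-]].
  by apply/ffunP => i; apply/val_inj/eqy.
exact: dvd_recip_den.
Qed.

Definition recip_cong F := [pred p : T * T |
  [&& [forall i, coprimep (npol p.1 i) F], [forall i, coprimep (npol p.2 i) F] &
    F %| recip_num (npol p.1) * recip_den (npol p.2) -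
         recip_num (npol p.2) * recip_den (npol p.1)]].

(** Exchanging the two tuples costs a factor 2 and makes the second denominator the smaller one.
    Solutions that are genuine identities fall under [card_recip_eq]; the others are counted by
    [card_recip_cong_neq] for each of the q^(k(n+1)) first tuples. *)
Lemma card_recip_cong F : (1 < size F)%N ->
  (#|recip_cong F| * q ^ (size F).-1 <= 2 * tau ^ (k + k) *
     (q ^ ((k * n).+1 + (size F).-1) + q ^ (k * n.+1 + (k.-1 * n + k * n).+2)))%N.
Proof.
move=> sF; have F0 : F != 0 by rewrite -size_poly_gt0 ltnW.
have unit_neq0 (y : {poly K}) : coprimep y F -> y != 0.
  by apply: contraTneq => ->; rewrite coprime0p -size_poly_eq1 gtn_eqF.
(* Positivity of [tau] allows tau^k to be enlarged to tau^(2k) below. *)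
have tau_gt0 : (0 < tau)%N.
  apply: leq_trans (ndiv_gt0 (oner_neq0 _)) (ndiv_tau (oner_neq0 _) _).
  by rewrite size_poly1; lia.
pose big (p : T * T) := (size (recip_den (npol p.2)) <= size (recip_den (npol p.1)))%N.
pose S := [pred p in recip_cong F | big p].
pose S' := [pred p in recip_cong F | big (p.2, p.1)].
have cover : (#|recip_cong F| <= #|S| + #|S'|)%N.
  apply: card_le_cover2 => p pE; apply/orP.
  by have /orP[le|le] := leq_total (size (recip_den (npol p.2)))
    (size (recip_den (npol p.1))); [left | right]; apply/andP.
have swap : (#|S'| <= #|S|)%N.
  apply: (card_le_inj (r := fun p p' : T * T => p' == (p.2, p.1))).
    move=> [x y] /andP[/= /and3P[xF yF E] le]; exists (y, x) => //.
    by rewrite !inE /= xF yF le -dvdpNr opprB E.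
  by move=> [x y] [x' y'] p' _ _ /= /eqP-> /eqP[-> ->].
rewrite -mulnA; apply: (@leq_trans (2 * (#|S| * q ^ (size F).-1))%N).
  by rewrite mulnA leq_mul2r mul2n -addnn (leq_trans cover) ?orbT // leq_add2l.
rewrite leq_mul2l /=.
pose S1 := [pred p in S | recip_num (npol p.1) * recip_den (npol p.2)
         == (recip_num (npol p.2) * recip_den (npol p.1))%R].
pose S2 := [pred p in S | recip_num (npol p.1) * recip_den (npol p.2)
         != (recip_num (npol p.2) * recip_den (npol p.1))%R].
have leS : (#|S| <= #|S1| + #|S2|)%N.
  by apply: card_le_cover2 => p pS; rewrite !inE /= in pS *; rewrite pS /= orbN.
have le1 : (#|S1| <= q ^ (k * n).+1 * tau ^ (k + k))%N.
  apply: leq_trans card_recip_eq; apply: subset_leq_card; apply/fintype.subsetP => p.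
  rewrite !inE => /andP[/andP[/and3P[/forallP xF /forallP yF _] _] ->]; rewrite andbT.
  by apply/andP; split; apply/forallP => i; apply: unit_neq0.
have le2 : (#|S2| * q ^ (size F).-1 <=
    q ^ (k * n.+1) * (q ^ (k.-1 * n + k * n).+2 * tau ^ k))%N.
  have -> : (q ^ (k * n.+1))%N = #|{: T}| by rewrite card_ffun card_npoly card_ord -expnM mulnC.
  rewrite -[leqRHS]sum_nat_const.
  pose P (x y : T) := (x, y) \in S2.
  rewrite (eq_card (B := [pred p : T * T | P p.1 p.2])); last by case.
  rewrite card_pairs big_distrl /=; apply: leq_sum => x _.
  have [xF|nxF] := boolP [forall i, coprimep (npol x i) F]; last first.
    by rewrite eq_card0 // => y; rewrite !inE /P !inE /= (negPf nxF).
  have coF : coprimep (recip_den (npol x)) F.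
    apply: (big_ind (fun y : {poly K} => coprimep y F)) => [|y z|i _].
    - exact: coprime1p.
    - by rewrite coprimepMl => -> ->.
    - exact: (forallP xF).
  have := card_recip_cong_neq (unit_neq0 _ coF) coF F0; apply: leq_trans.
  rewrite leq_mul2r; apply/orP; right; apply: subset_leq_card; apply/fintype.subsetP => y.
  rewrite !inE /P !inE /= => /andP[/andP[/and3P[_ /forallP yF ->] le] ->].
  rewrite /big /= in le; rewrite le !andbT.
  by apply/forallP => i; apply: unit_neq0.
apply: leq_trans (_ : (#|S1| + #|S2|) * q ^ (size F).-1 <= _)%N.
  by rewrite leq_mul2r leS orbT.
rewrite mulnDl mulnDr; apply: leq_add.
  by rewrite [(q ^ (_ + (size F).-1))%N]expnD mulnA leq_mul2r [leqRHS]mulnC le1 orbT.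
apply: leq_trans le2 _; rewrite [(q ^ (k * _ + _))%N]expnD mulnA mulnC leq_mul2r.
by rewrite leq_pexp2l ?orbT // leq_addr.
Qed.

End RecipEnergy.

End RecipSums.

(** * Congruences with two reciprocals on each side *)

Section RecipQuadruples.
Variable K : finFieldType.
Implicit Types P X Y d a b F : {poly K}.
Local Notation q := #|K|.
Lemma eq_of_dvd_sub F a b : F %| a - b -> (size a < size F)%N -> (size b < size F)%N ->
  a = b.
Proof.
move=> Fab sa sb; apply/eqP; rewrite -subr_eq0; apply: contraTT Fab => ab0.
apply/negP => /(size_dvd ab0); rewrite leqNgt => /negP[].
by apply: leq_ltn_trans (size_polyD _ _) _; rewrite size_polyN gtn_max sa.
Qed.

Lemma coprimep_of_cong F c d u : coprimep u F -> F %| c * d - u -> coprimep c F.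
Proof.
move=> /coprimepP uF Fcd; apply/coprimepP => g gc gF; apply: uF => //.
have -> : u = c * d - (c * d - u) by rewrite opprB addrC subrK.
by rewrite dvdp_sub ?dvdp_mulr // (dvdp_trans gF).
Qed.

(** Thue's pigeonhole argument: q^(m+1) candidates [t] share the q^m possible blocks of top [m]
    coefficients of [l t] modulo [F]. The difference of two candidates with equal blocks is the
    required multiplier. *)
Lemma small_multiple F l m : F != 0 -> (m < size F)%N ->
  exists t : {poly K}, [/\ t != 0, (size t <= m.+1)%N
    & (size ((l * t) %% F)%R <= (size F).-1 - m)%N].
Proof.
move=> F0 mF; set c := ((size F).-1 - m)%N.
pose f (t : {poly_(m.+1) K}) : {poly_m K} := npolyp m (((l * polyn t) %% F) %/ 'X^c).
have /injectivePn[t1 [t2 t12 ft12]] : ~~ injectiveb f.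
  apply/negP => /injectiveP/leq_card; rewrite !card_npoly leq_exp2l ?q_gt1 //.
  by rewrite ltnn.
have Xc0 : ('X^c : {poly K}) != 0 by rewrite monic_neq0 ?monicXn.
have sq t : (size (((l * polyn t) %% F) %/ 'X^c)%R <= m)%N.
  rewrite size_divp // size_polyXn /= leq_subLR /c.
  have := ltn_modpN0 (l * polyn t) F0; move: mF; clear.
  by move: (size _) (size _) => a b; lia.
exists (polyn t1 - polyn t2); split.
- by rewrite subr_eq0; apply: contra t12 => /eqP/val_inj->.
- by rewrite (leq_trans (size_polyD _ _)) // size_polyN geq_max !size_npoly.
rewrite mulrBr modpD modpN.
have := congr1 (@polyn K m) ft12; rewrite /f !npolypK // => eqq.
rewrite (divp_eq ((l * polyn t1) %% F) 'X^c) eqq.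
rewrite {2}(divp_eq ((l * polyn t2) %% F) 'X^c) opprD addrACA subrr add0r.
apply: leq_trans (size_polyD _ _) _; rewrite size_polyN geq_max.
by rewrite -!(ltnS _ c) -(size_polyXn K c) !ltn_modpN0.
Qed.

Section RecipPairs.
Variables (F : {poly K}) (n s tau : nat).
Local Notation r := (size F).-1.
Hypothesis sF : (n.+1 < size F)%N.
Hypothesis ndiv_tau : forall X, X != 0 -> (size X <= s)%N -> (ndiv X <= tau)%N.
Hypothesis s_large : (2 * (size F + n) <= s)%N.
Local Notation N := {poly_(n.+1) K}.
Implicit Types x y : {poly K}.

Definition recip_cong2 x1 x2 x3 x4 :=
  F %| (x1 + x2) * (x3 * x4) - (x3 + x4) * (x1 * x2).

Lemma modulus_neq0 : F != 0.
Proof. by rewrite -size_poly_gt0; apply: leq_trans sF. Qed.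
Let F0 := modulus_neq0.

Lemma unit_neq0 x : coprimep x F -> x != 0.
Proof.
apply: contraTneq => ->; rewrite coprime0p -size_poly_eq1.
by move: sF; case: (size F) => [|[]].
Qed.

(** The congruence is linear in [x4], namely c x4 = x1 x2 x3 modulo [F]. As the right side is a
    unit, so is [c], and [x4] is too short for two values to share a residue. *)
Lemma recip_cong2_inj x1 x2 x3 x4 x4' :
  [/\ coprimep x1 F, coprimep x2 F & coprimep x3 F] ->
  (size x4 <= n.+1)%N -> (size x4' <= n.+1)%N ->
  recip_cong2 x1 x2 x3 x4 -> recip_cong2 x1 x2 x3 x4' -> x4 = x4'.
Proof.
move=> [x1F x2F x3F] s4 s4' E E'.
apply: (@eq_of_dvd_sub F); [|exact: leq_ltn_trans sF|exact: leq_ltn_trans sF].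
pose c := (x1 + x2) * x3 - x1 * x2.
have cF : coprimep c F.
  apply: (@coprimep_of_cong _ c x4 (x3 * (x1 * x2))); first by rewrite !coprimepMl x1F x2F x3F.
  by move: E; rewrite /recip_cong2; congr (_ %| _); rewrite /c; ring.
rewrite -(Gauss_dvdpr _ (_ : coprimep F c)) 1?coprimep_sym //.
have -> : c * (x4 - x4') = ((x1 + x2) * (x3 * x4) - (x3 + x4) * (x1 * x2)) -
    ((x1 + x2) * (x3 * x4') - (x3 + x4') * (x1 * x2)) by rewrite /c; ring.
exact: dvdp_sub.
Qed.

Section Level.
Variable m : nat.
Hypothesis mF : (m < size F)%N.

(** The pairs for which the approximation z / t of 1/x1 + 1/x2 may have z = 0; they include x1 = -
    x2. *)
Definition degenerate x1 x2 :=
  [exists t : {poly_(m.+1) K}, (polyn t != 0) && (F %| polyn t * (x1 + x2))].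

Lemma degenerateP x1 x2 : degenerate x1 x2 ->
  exists t : {poly K}, [/\ t != 0, (size t <= m.+1)%N & F %| t * (x1 + x2)].
Proof.
by move=> /existsP[t /andP[t0 Ft]]; exists (polyn t); split=> //; apply: size_npoly.
Qed.

Definition units4 (p : (N * N) * (N * N)) :=
  [&& coprimep (polyn p.1.1) F, coprimep (polyn p.1.2) F, coprimep (polyn p.2.1) F
    & coprimep (polyn p.2.2) F].

(** If [t] annihilates x1 + x2 modulo [F], then F divides t g with g = gcd(x1 + x2, F), so g is a
    divisor of [F] of degree at least r - m. Given g, the multiple x1 + x2 = g h leaves few values
    of h; then x1, h and x3 determine x2 and, by [recip_cong2_inj], x4. *)
Lemma card_degenerate :
  (#|[pred p : (N * N) * (N * N) | [&& units4 p,
      recip_cong2 (polyn p.1.1) (polyn p.1.2) (polyn p.2.1) (polyn p.2.2) &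
      degenerate (polyn p.1.1) (polyn p.1.2)]]|
   <= ndiv F * q ^ (n.+1 + (n.+1 + m - r) + n.+1))%N.
Proof.
pose B := [pred d : {poly_(size F) K} | (polyn d %| F) && (r < size (polyn d) + m)%N].
apply: (@leq_trans (#|B| * q ^ (n.+1 + (n.+1 + m - r) + n.+1))); last first.
  rewrite leq_mul2r; apply/orP; right; apply: subset_leq_card.
  by apply/fintype.subsetP => d /andP[].
apply: (card_le_fiber (r := fun p (d : {poly_(size F) K}) =>
  polyn d %| polyn p.1.1 + polyn p.1.2)).
  move=> [[x1 x2] [x3 x4]] /and3P[/= _ _ /degenerateP[t [t0 st Ft]]].
  set g : {poly K} := gcdp (polyn x1 + polyn x2) F.
  have gF : g %| F by apply: dvdp_gcdr.
  have g0 : g != 0 by rewrite gcdp_eq0 negb_and F0 orbT.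
  have tg0 : t * g != 0 by rewrite mulf_neq0.
  have Ftg : F %| t * g.
    by rewrite (eqp_dvdr _ (mulp_gcdr _ _ _)) dvdp_gcd Ft dvdp_mull.
  have sg : (r < size g + m)%N.
    by move: (size_dvd tg0 Ftg) (sizeM t0 g0) (size_gt0 F0) st; clear; lia.
  exists (npolyp (size F) g); last by rewrite npolypK ?size_dvd // dvdp_gcdl.
  by rewrite inE npolypK ?size_dvd // gF /=.
move=> d /andP[dF sd]; pose D : {poly K} := polyn d.
rewrite !expnD -[(q ^ n.+1)%N]card_npoly -[(q ^ (_ - _))%N]card_npoly -!card_prod.
apply: (card_le_inj (r := fun (p : (N * N) * (N * N))
    (u : N * {poly_(n.+1 + m - r) K} * N) =>
  [&& p.1.1 == u.1.1, p.2.1 == u.2 & polyn p.1.1 + polyn p.1.2 == polyn d * polyn u.1.2])).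
  move=> [[x1 x2] [x3 x4]] /andP[_ /= /dvdp_factor[h hE]].
  have sh : (size h <= n.+1 + m - r)%N.
    have [->|h0] := eqVneq h 0; first by rewrite size_poly0.
    have D0 : D != 0 by apply: contraTneq dF => D0; rewrite -/D D0 dvd0p.
    have : (size (D * h)%R <= n.+1)%N.
      by rewrite -hE (leq_trans (size_polyD _ _)) // geq_max !size_npoly.
    have {}sd : (r < size D + m)%N by [].
    by move: (sizeM D0 h0) sd; clear; lia.
  exists (x1, npolyp (n.+1 + m - r) h, x3) => //=.
  by rewrite !eqxx npolypK // hE eqxx.
move=> [[x1 x2] [x3 x4]] [[y1 y2] [y3 y4]] [[u1 u2] u3] /andP[/and3P[/= xU xE _] _].
move=> /andP[/and3P[/= yU yE _] _] /and3P[/= /eqP eq1 /eqP eq3 /eqP eq2].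
move=> /and3P[/= /eqP eq1' /eqP eq3' /eqP eq2'].
subst u1 u3 y1 y3; have ex2 : x2 = y2.
  by apply/val_inj/(addrI (polyn x1)); rewrite /= eq2 eq2'.
subst y2; congr (_, (_, _)); apply/val_inj.
case/and4P: xU => /= x1F x2F x3F _.
by apply: recip_cong2_inj xE yE => //; apply: size_npoly.
Qed.

(** With z / t a short representation of 1/x1 + 1/x2 modulo [F], the congruence becomes z y1 y2 - t
    (y1 + y2) = F w. The size of w is bounded, and multiplying by z and adding t^2 factors the left
    side as (z y1 - t)(z y2 - t). Each w then allows at most [tau] solutions if the product is
    nonzero, and at most two otherwise. *)
Lemma card_nondegenerate (x1 x2 : N) :
  coprimep (polyn x1) F -> coprimep (polyn x2) F -> ~~ degenerate (polyn x1) (polyn x2) ->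
  (#|[pred y : N * N | [&& coprimep (polyn y.1) F, coprimep (polyn y.2) F &
      recip_cong2 (polyn x1) (polyn x2) (polyn y.1) (polyn y.2)]]|
   <= q ^ (maxn (r - m + 2 * n) (m + n).+1 - r) * (tau + 2))%N.
Proof.
move=> x1F x2F /existsPn nd; set S := [pred y : N * N | _].
have /Bezout_eq1_coprimepP[[i v] /= iE] : coprimep (polyn x1 * polyn x2) F.
  by rewrite coprimepMl x1F.
have [t [t0 st]] := small_multiple ((polyn x1 + polyn x2) * i) F0 mF.
set z : {poly K} := (_ %% F) => sz.
have zE : F %| (polyn x1 + polyn x2) * i * t - z.
  by rewrite /z {1}(divp_eq ((polyn x1 + polyn x2) * i * t) F) addrK dvdp_mull.
(* As [i] is a unit modulo [F], z = 0 would mean that [t] annihilates x1 + x2, which is the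
   degenerate case. *)
have z0 : z != 0.
  apply: contraNneq (nd (npolyp m.+1 t)) => z0; rewrite npolypK // t0 /=.
  move: zE; rewrite z0 subr0 mulrAC Gauss_dvdpl ?[t * _]mulrC //.
  rewrite coprimep_sym; apply/Bezout_eq1_coprimepP.
  by exists (polyn x1 * polyn x2, v) => /=; rewrite mulrC.
have EF (y : N * N) : y \in S -> F %| z * (polyn y.1 * polyn y.2) - t * (polyn y.1 + polyn y.2).
  move=> /and3P[_ _ yE].
  have -> : z * (polyn y.1 * polyn y.2) - t * (polyn y.1 + polyn y.2) =
      i * t * ((polyn x1 + polyn x2) * (polyn y.1 * polyn y.2)
               - (polyn y.1 + polyn y.2) * (polyn x1 * polyn x2))
      - ((polyn x1 + polyn x2) * i * t - z) * (polyn y.1 * polyn y.2)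
      - (1 - i * (polyn x1 * polyn x2)) * (t * (polyn y.1 + polyn y.2)) by ring.
  apply: dvdp_sub; first by apply: dvdp_sub; [apply: dvdp_mull | apply: dvdp_mulr].
  by rewrite -iE addrAC subrr add0r dvdp_mulr // dvdp_mull.
set W := (_ - r)%N.
rewrite -[(q ^ W)%N]card_npoly; apply: (card_le_fiber (r := fun (y : N * N) (w : {poly_W K}) =>
  z * (polyn y.1 * polyn y.2) - t * (polyn y.1 + polyn y.2) == F * polyn w)).
  move=> y yS; have /dvdp_factor[w wE] := EF y yS.
  suff sw : (size w <= W)%N by exists (npolyp W w); rewrite // npolypK ?wE.
  have [->|w0] := eqVneq w 0; first by rewrite size_poly0.
  have s1 : (size (polyn y.1 : {poly K}) <= n.+1)%N by apply: size_npoly.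
  have s2 : (size (polyn y.2 : {poly K}) <= n.+1)%N by apply: size_npoly.
  have : (size (F * w)%R <= maxn (r - m + 2 * n) (m + n).+1)%N.
    rewrite -wE; apply: leq_trans (size_polyD _ _) _; rewrite size_polyN.
    rewrite geq_max !leq_max; apply/andP; split; apply/orP; [left|right].
      apply: leq_trans (size_polyMleq _ _) _.
      have : (size (polyn y.1 * polyn y.2)%R <= (2 * n).+1)%N.
        apply: leq_trans (size_polyMleq _ _) _; move: s1 s2; clear.
        by move: (size (polyn y.1)) (size (polyn y.2)) => a b; lia.
      move: sz (size_gt0 z0); clear.
      by move: (size z) (size (polyn _ * _)%R) (size F) => a b c; lia.
    apply: leq_trans (size_polyMleq _ _) _.
    have : (size (polyn y.1 + polyn y.2)%R <= n.+1)%N.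
      by apply: leq_trans (size_polyD _ _) _; rewrite geq_max s1.
    by move: st (size_gt0 t0); clear; move: (size t) (size (polyn _ + _)%R) => a b; lia.
  move: (sizeM F0 w0) (size_gt0 F0) (size_gt0 w0); rewrite /W; clear.
  move: (size F) (size w) (size (F * w)) => f ? ?; lia.
move=> w _; set Sw := [pred y in S | _]; set R := t ^+ 2 + z * (F * polyn w).
have RE (y : N * N) : y \in Sw -> (z * polyn y.1 - t) * (z * polyn y.2 - t) = R.
  by move=> /andP[_ /eqP yE]; rewrite /R -yE; ring.
have z_inj : injective (fun x => z * x - t) by move=> x y /addIr/(mulfI z0).
have det (y y' : N * N) : y \in Sw -> y' \in Sw ->
    z * polyn y.1 - t = z * polyn y'.1 - t -> y = y'.
  case: y y' => [y1 y2] [y1' y2'] /andP[/and3P[/= y1F y2F yE] _].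
  move=> /andP[/and3P[/= y1'F y2'F yE'] _] /z_inj/val_inj eq1; subst y1'.
  congr (_, _); apply/val_inj; apply: recip_cong2_inj yE yE' => //; exact: size_npoly.
have [R0|R0] := eqVneq R 0; last first.
  have [/card0_eq S0|] := posnP #|Sw|; first by rewrite (eq_card0 S0).
  case/card_gt0P => y0 y0S.
  have le_tau : (ndiv R <= tau)%N.
    apply: ndiv_tau => //; rewrite -(RE y0) //.
    apply: leq_trans (size_polyMleq _ _) _.
    have sx (x : N) : (size (z * polyn x - t)%R <= size F + n)%N.
      have sx : (size (polyn x : {poly K}) <= n.+1)%N by apply: size_npoly.
      apply: leq_trans (size_polyD _ _) _; rewrite size_polyN geq_max.
      apply/andP; split; last by move: st mF; clear; move: (size t) (size F) => a b; lia.
      apply: leq_trans (size_polyMleq _ _) _; move: sz sx; clear.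
      by move: (size z) (size (polyn x)) (size F) => a b c; lia.
    move: (sx y0.1) (sx y0.2) s_large; clear.
    by move: (size (_ - t)) (size (_ - t)) (size F) => a b c; lia.
  apply: leq_trans (leq_trans le_tau (leq_addr _ _)).
  apply: (@card_dvd_inj _ _ _ (fun y : N * N => z * polyn y.1 - t)) => // y yS.
  by rewrite -(RE y yS) dvdp_mulIl.
apply: (@leq_trans 2); last exact: leq_addl.
rewrite -card_bool.
apply: (card_le_inj (r := fun (y : N * N) (b : bool) => (z * polyn y.1 - t == 0) == b)) => [y _|].
  by exists (z * polyn y.1 - t == 0).
move=> y y' b yS yS'; case: b => /=.
  by rewrite !eqb_id => /eqP y1 /eqP y1'; apply: det => //; rewrite y1 y1'.
rewrite !eqbF_neg => y1 y1'.
have /eqP := RE y yS; rewrite R0 mulf_eq0 (negPf y1) => /eqP y2.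
have /eqP := RE y' yS'; rewrite R0 mulf_eq0 (negPf y1') => /eqP y2'.
case: y y' yS yS' {y1 y1'} y2 y2' => [y1 y2] [y1' y2'] /andP[/and3P[/= y1F y2F yE] _].
move=> /andP[/and3P[/= y1'F y2'F yE'] _] eq2 eq2'.
have /z_inj/val_inj eqy : z * polyn y2 - t = z * polyn y2' - t by rewrite eq2.
subst y2'; congr (_, _); apply/val_inj.
have swap x y : recip_cong2 (polyn x1) (polyn x2) x y -> recip_cong2 (polyn x1) (polyn x2) y x.
  by rewrite /recip_cong2 [x * y]mulrC [x + y]addrC.
by apply: recip_cong2_inj (swap _ _ yE) (swap _ _ yE') => //; apply: size_npoly.
Qed.

End Level.

Lemma card_recip_cong2 e : (3 * n < 2 * e + r)%N ->
  (#|recip_cong 2 n F| <= 2 * (tau + 2) * q ^ (2 * n.+1 + e))%N.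
Proof.
(* This is the largest admissible level with m <= e + r - (n + 1), the condition under which both
   the degenerate count and the term (m + n + 1) - r fit the exponent. The remaining condition 2n -
   m <= e then follows from 3n < 2e + r, or from n < r when m = r. *)
move=> large_e; set m := minn r (e + r - n.+1).
have mF : (m < size F)%N by rewrite /m; move: sF; clear; lia.
pose Q := [pred p : (N * N) * (N * N) | units4 p &&
  recip_cong2 (polyn p.1.1) (polyn p.1.2) (polyn p.2.1) (polyn p.2.2)].
apply: (@leq_trans #|Q|).
  have ord2 (i : 'I_2) : i = ord0 \/ i = ord_max.
    by case: i => [[|[|]] // lt_i]; [left|right]; apply/val_inj.
  apply: (card_le_inj (r := fun (p : {ffun 'I_2 -> N} * {ffun 'I_2 -> N})
      (u : (N * N) * (N * N)) =>
    u == ((p.1 ord0, p.1 ord_max), (p.2 ord0, p.2 ord_max)))).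
    move=> [x y] /and3P[/= /forallP xF /forallP yF E].
    exists ((x ord0, x ord_max), (y ord0, y ord_max)) => //.
    rewrite !inE /units4 /= (xF ord0) (xF ord_max) (yF ord0) (yF ord_max) /=.
    have num2 (u : {ffun 'I_2 -> N}) :
        recip_num (npol u) = polyn (u ord0) + polyn (u ord_max).
      rewrite /recip_num big_ord_recl big_ord1 addrC; congr (_ + _).
        rewrite big_mkcond big_ord_recl big_ord1 /= mulr1.
        by [].
      rewrite big_mkcond big_ord_recl big_ord1 /= mul1r /npol; congr (polyn (u _)).
      exact/val_inj.
    have den2 (u : {ffun 'I_2 -> N}) :
        recip_den (npol u) = polyn (u ord0) * polyn (u ord_max).
      rewrite /recip_den big_ord_recl big_ord1 /npol; congr (_ * polyn (u _)).
      exact/val_inj.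
    by move: E; rewrite !num2 !den2.
  move=> [x y] [x' y'] u _ _ /= /eqP-> /eqP[e1 e2 e3 e4].
  by congr (_, _); apply/ffunP => i; case: (ord2 i) => ->.
pose D := [pred p : (N * N) * (N * N) | [&& units4 p,
      recip_cong2 (polyn p.1.1) (polyn p.1.2) (polyn p.2.1) (polyn p.2.2) &
      degenerate m (polyn p.1.1) (polyn p.1.2)]].
pose G := [pred p in Q | ~~ degenerate m (polyn p.1.1) (polyn p.1.2)].
apply: (@leq_trans (#|D| + #|G|)).
  apply: card_le_cover2 => p; rewrite !inE => /andP[pU pE].
  by rewrite pU pE /= orbN.
have ndivF : (ndiv F <= tau)%N.
  by apply: ndiv_tau => //; move: s_large; clear; lia.
have -> : (2 * (tau + 2) * q ^ (2 * n.+1 + e) =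
    (tau + 2) * q ^ (2 * n.+1 + e) + (tau + 2) * q ^ (2 * n.+1 + e))%N by ring.
apply: leq_add.
  apply: leq_trans (card_degenerate m) _; apply: leq_mul.
    by apply: leq_trans ndivF _; rewrite leq_addr.
  by rewrite leq_exp2l ?q_gt1 // /m; move: sF; clear; lia.
pose P (x y : N * N) := (x, y) \in G.
rewrite (eq_card (B := [pred p | P p.1 p.2])); last by case.
rewrite card_pairs.
apply: (@leq_trans (\sum_(x : N * N) q ^ e * (tau + 2))); last first.
  rewrite sum_nat_const card_prod card_npoly -expnD addnn -mul2n.
  by rewrite expnD mulnA mulnC.
apply: leq_sum => -[x1 x2] _.
have [/and3P[x1F x2F nd]|bad] := boolP [&& coprimep (polyn x1) F, coprimep (polyn x2) F
    & ~~ degenerate m (polyn x1) (polyn x2)]; last first.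
  rewrite eq_card0 // => y; apply/negP => /andP[/andP[/and4P[/= x1F x2F _ _] _] nd].
  by rewrite x1F x2F nd in bad.
apply: leq_trans (_ : q ^ (maxn (r - m + 2 * n) (m + n).+1 - r) * (tau + 2) <= _)%N.
  apply: leq_trans (card_nondegenerate mF x1F x2F nd); apply: subset_leq_card.
  by apply/fintype.subsetP => y /andP[/andP[/and4P[_ _ /= y1F y2F] E] _]; rewrite !inE y1F y2F.
rewrite leq_mul2r leq_exp2l ?q_gt1 //; apply/orP; right.
by move: sF large_e; rewrite /m; clear; lia.
Qed.

End RecipPairs.
End RecipQuadruples.

(** * Bilinear sums *)

Section SumInequalities.
Variables (C : numDomainType) (I : finType).
Implicit Types a b t : I -> C.

Lemma sum_mul_sum t b : (\sum_i t i) * (\sum_i b i) = \sum_i \sum_j t i * b j.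
Proof. by rewrite mulr_suml; apply: eq_bigr => i _; rewrite mulr_sumr. Qed.

Lemma sum_mul_sumC t b : (\sum_i t i) * (\sum_i b i) = \sum_i \sum_j t j * b i.
Proof.
rewrite mulrC sum_mul_sum; apply: eq_bigr => i _; apply: eq_bigr => j _.
by rewrite mulrC.
Qed.

(** Twice the difference of the two sides is the double sum of (t_i - t_j)(t_i^k - t_j^k), whose
    factors have the same sign. *)
Lemma chebyshev_sum t k : (forall i, 0 <= t i) ->
  (\sum_i t i) * (\sum_i t i ^+ k) <= #|I|%:R * \sum_i t i ^+ k.+1.
Proof.
move=> t0; rewrite -subr_ge0 -(pmulrn_lge0 _ (ltn0Sn 1)).
have -> : (#|I|%:R * (\sum_i t i ^+ k.+1) - (\sum_i t i) * (\sum_i t i ^+ k)) *+ 2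
    = \sum_i \sum_j (t i - t j) * (t i ^+ k - t j ^+ k).
  have e1 : #|I|%:R * (\sum_i t i ^+ k.+1) = \sum_i \sum_(j : I) t i ^+ k.+1.
    rewrite mulr_sumr; apply: eq_bigr => i _.
    by rewrite sumr_const -[in RHS]mulr_natl.
  have e2 : #|I|%:R * (\sum_i t i ^+ k.+1) = \sum_(i : I) \sum_j t j ^+ k.+1.
    by rewrite sumr_const mulr_natl.
  rewrite mulr2n {1}e1 e2 {1}sum_mul_sum sum_mul_sumC addrACA -opprD -!big_split /=.
  rewrite -sumrB; apply: eq_bigr => i _; rewrite -!big_split /= -sumrB.
  by apply: eq_bigr => j _; rewrite !exprS; ring.
apply: sumr_ge0 => i _; apply: sumr_ge0 => j _.
have [le_ij|/ltW le_ji] := real_leP (ger0_real (t0 i)) (ger0_real (t0 j)).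
  by rewrite mulr_le0 // subr_le0 // lerXn2r // nnegrE.
by rewrite mulr_ge0 // subr_ge0 // lerXn2r // nnegrE.
Qed.

Lemma power_mean t k : (forall i, 0 <= t i) ->
  (\sum_i t i) ^+ k.+1 <= #|I|%:R ^+ k * \sum_i t i ^+ k.+1.
Proof.
move=> t0; elim: k => [|k IHk]; first by rewrite expr1 mul1r lexx.
have s0 : 0 <= \sum_i t i by apply: sumr_ge0.
rewrite exprS (le_trans (ler_wpM2l s0 IHk)) // mulrCA exprSr -mulrA.
by rewrite ler_wpM2l ?exprn_ge0 // chebyshev_sum.
Qed.

(** Lagrange's identity: twice the difference is the double sum of the squares (a_i b_j - a_j
    b_i)^2. *)
Lemma cauchy_schwarz_sum a b : (forall i, 0 <= a i) -> (forall i, 0 <= b i) ->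
  (\sum_i a i * b i) ^+ 2 <= (\sum_i a i ^+ 2) * (\sum_i b i ^+ 2).
Proof.
move=> a0 b0; rewrite -subr_ge0 -(pmulrn_lge0 _ (ltn0Sn 1)).
suff -> : ((\sum_i a i ^+ 2) * (\sum_i b i ^+ 2) - (\sum_i a i * b i) ^+ 2) *+ 2
    = \sum_i \sum_j (a i * b j - a j * b i) ^+ 2.
  apply: sumr_ge0 => i _; apply: sumr_ge0 => j _; apply: real_exprn_even_ge0 => //.
  by rewrite rpredB // rpredM // ger0_real.
rewrite mulr2n {1}sum_mul_sum sum_mul_sumC expr2 sum_mul_sum addrACA -opprD -!big_split /=.
rewrite -sumrB; apply: eq_bigr => i _; rewrite -!big_split /= -sumrB.
by apply: eq_bigr => j _; ring.
Qed.

End SumInequalities.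

Section BilinearSums.
Variable C : numClosedFieldType.

(** Hölder's inequality over [j]. The phases [Q'] turn the moment of the inner sums back into a
    bilinear sum, in which [i] is replaced by a (k+1)-tuple and the weights on [j] are bounded by 1.
    This form lets the step be repeated with the variables exchanged. *)
Lemma power_step (I J : finType) (P : I -> C) (Q : J -> C) (f : I -> J -> C) (b : C) k :
  (forall j, `|Q j| <= b) ->
  exists2 Q' : J -> C, forall j, `|Q' j| <= 1 &
  `|\sum_j \sum_i Q j * P i * f i j| ^+ k.+1 <= b ^+ k.+1 * #|J|%:R ^+ k *
    `|\sum_j \sum_(h : {ffun 'I_k.+1 -> I})
        Q' j * (\prod_s P (h s)) * \prod_s f (h s) j|.
Proof.
move=> Qb; pose G j := \sum_i P i * f i j.
(* The phase is unimodular except where [G] vanishes; the value 0 chosen there still has modulus at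
   most 1. *)
pose Q' j := if G j == 0 then 0 else `|G j| ^+ k.+1 / G j ^+ k.+1.
have Q'G j : Q' j * G j ^+ k.+1 = `|G j| ^+ k.+1.
  rewrite /Q'; have [->|Gj] := eqVneq; first by rewrite mul0r normr0 expr0n.
  by rewrite divfK // expf_neq0.
exists Q' => [j|].
  rewrite /Q'; have [_|Gj] := eqVneq; first by rewrite normr0 ler01.
  by rewrite normrM normfV !normrX normr_id divff // expf_neq0 // normr_eq0.
have -> : \sum_j \sum_(h : {ffun 'I_k.+1 -> I})
    Q' j * (\prod_s P (h s)) * \prod_s f (h s) j = \sum_j `|G j| ^+ k.+1.
  apply: eq_bigr => j _; rewrite -Q'G -[in RHS](card_ord k.+1) -prodr_const.
  rewrite /G bigA_distr_bigA mulr_sumr; apply: eq_bigr => h _.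
  by rewrite -mulrA -big_split.
have sum0 : 0 <= \sum_j `|G j| ^+ k.+1 by apply: sumr_ge0 => j _; rewrite exprn_ge0.
rewrite (ger0_norm sum0).
have -> : \sum_j \sum_i Q j * P i * f i j = \sum_j Q j * G j.
  by apply: eq_bigr => j _; rewrite mulr_sumr; apply: eq_bigr => i _; rewrite mulrA.
have le1 : `|\sum_j Q j * G j| <= \sum_j `|Q j| * `|G j|.
  apply: le_trans (ler_norm_sum _ _ _) _; apply: ler_sum => j _.
  by rewrite normrM.
apply: le_trans (_ : (\sum_j `|Q j| * `|G j|) ^+ k.+1 <= _).
  by rewrite lerXn2r // nnegrE //; apply: sumr_ge0 => j _; rewrite mulr_ge0.
apply: le_trans (power_mean _ _) _ => [j|]; first by rewrite mulr_ge0.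
rewrite mulrAC mulrC ler_wpM2r ?exprn_ge0 // mulr_sumr; apply: ler_sum => j _.
by rewrite exprMn ler_wpM2r ?exprn_ge0 // lerXn2r // nnegrE // (le_trans _ (Qb j)).
Qed.

(** * Bilinear sums over a self-dual finite group *)

Section Pairing.
Variables (V : finZmodType) (chi : V -> V -> C).
Hypothesis chiDl : forall u u' v, chi (u + u') v = chi u v * chi u' v.
Hypothesis chiDr : forall u v v', chi u (v + v') = chi u v * chi u v'.
Hypothesis chi_orth : forall v v',
  \sum_u chi u v * (chi u v')^* = #|V|%:R *+ (v == v').

Definition collisions (I : finType) (u : I -> V) :=
  #|[pred p : I * I | u p.1 == u p.2]|.

(** Group the terms by the value w of [u] and apply Cauchy-Schwarz over w. The square mean of the
    grouped weights is at most the number of collisions of [u]; that of the character sums is, by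
    orthogonality, #|V| times a weighted count of the collisions of [v]. *)
Lemma bilinear_collisions (I J : finType) (P : I -> C) (Q : J -> C)
    (u : I -> V) (v : J -> V) :
  (forall i, `|P i| <= 1) -> (forall j, `|Q j| <= 1) ->
  `|\sum_i \sum_j P i * Q j * chi (u i) (v j)| ^+ 2
    <= #|V|%:R * (collisions u)%:R * (collisions v)%:R.
Proof.
move=> P1 Q1; pose p (w : V) := \sum_(i | u i == w) P i.
pose G (w : V) := \sum_j Q j * chi w (v j).
have -> : \sum_i \sum_j P i * Q j * chi (u i) (v j) = \sum_w p w * G w.
  rewrite (partition_big u predT) //=; apply: eq_bigr => w _.
  rewrite mulr_suml; apply: eq_bigr => i /eqP <-.
  by rewrite mulr_sumr; apply: eq_bigr => j _; rewrite mulrA.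
have pair_sum (K : finType) (w : K -> V) (c : K -> K -> C) :
    \sum_i \sum_(j | w i == w j) c i j = \sum_(x : K * K | w x.1 == w x.2) c x.1 x.2.
  by rewrite (pair_big_dep xpredT (fun i j => w i == w j)).
have le_coll (K : finType) (w : K -> V) (c : K -> K -> C) :
    (forall i j, `|c i j| <= 1) -> `|\sum_i \sum_(j | w i == w j) c i j| <= (collisions w)%:R.
  move=> c1; rewrite pair_sum; apply: le_trans (ler_norm_sum _ _ _) _.
  rewrite /collisions -sum1_card natr_sum; apply: ler_sum => x _; exact: c1.
have sum_sqr_ge0 (t : V -> C) : 0 <= \sum_w `|t w| ^+ 2.
  by apply: sumr_ge0 => w _; rewrite exprn_ge0.
have p2 : \sum_w `|p w| ^+ 2 <= (collisions u)%:R.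
  rewrite -[leLHS]ger0_norm //.
  have -> : \sum_w `|p w| ^+ 2 = \sum_i \sum_(j | u i == u j) P i * (P j)^*.
    rewrite [RHS](partition_big u predT) //=; apply: eq_bigr => w _.
    rewrite normCK /p rmorph_sum mulr_suml; apply: eq_bigr => i /eqP <-.
    by rewrite mulr_sumr; apply: eq_bigl => j; rewrite eq_sym.
  by apply: le_coll => i j; rewrite normrM norm_conjC mulr_ile1.
have G2 : \sum_w `|G w| ^+ 2 <= #|V|%:R * (collisions v)%:R.
  rewrite -[leLHS]ger0_norm //.
  have -> : \sum_w `|G w| ^+ 2 = #|V|%:R * \sum_i \sum_(j | v i == v j) Q i * (Q j)^*.
    transitivity (\sum_i \sum_j Q i * (Q j)^* * \sum_w chi w (v i) * (chi w (v j))^*).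
      transitivity (\sum_w \sum_i \sum_j Q i * (Q j)^* * (chi w (v i) * (chi w (v j))^*)).
        apply: eq_bigr => w _; rewrite normCK /G rmorph_sum mulr_suml.
        apply: eq_bigr => i _; rewrite mulr_sumr; apply: eq_bigr => j _.
        by rewrite rmorphM mulrACA.
      rewrite exchange_big; apply: eq_bigr => i _; rewrite exchange_big.
      by apply: eq_bigr => j _; rewrite mulr_sumr.
    rewrite mulr_sumr; apply: eq_bigr => i _; rewrite mulr_sumr [RHS]big_mkcond /=.
    apply: eq_bigr => j _; rewrite chi_orth; case: (v i == v j); last by rewrite mulr0.
    by rewrite mulrC.
  rewrite normrM normr_nat ler_wpM2l //.
  by apply: le_coll => i j; rewrite normrM norm_conjC mulr_ile1.
have le1 : `|\sum_w p w * G w| <= \sum_w `|p w| * `|G w|.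
  apply: le_trans (ler_norm_sum _ _ _) _; apply: ler_sum => w _.
  by rewrite normrM.
apply: le_trans (_ : (\sum_w `|p w| * `|G w|) ^+ 2 <= _).
  by rewrite lerXn2r // nnegrE //; apply: sumr_ge0 => w _; rewrite mulr_ge0.
apply: le_trans (cauchy_schwarz_sum _ _) _ => //.
by rewrite mulrAC mulrC ler_pM.
Qed.

(** The value is idempotent, hence 0 or 1; if it were 0, then [chi] would vanish at all (u, v),
    against orthogonality at v = v'. *)
Lemma pairing0l v : chi 0 v = 1.
Proof.
have /eqP : chi 0 v * (chi 0 v - 1) = 0 by rewrite mulrBr mulr1 -chiDl addr0 subrr.
rewrite mulf_eq0 subr_eq0 => /orP[/eqP v0|/eqP//].
have := chi_orth v v; rewrite eqxx big1 => [/eqP|u _].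
  by rewrite eq_sym mulrb pnatr_eq0 (cardD1 0).
by rewrite -[u]addr0 chiDl v0 mulr0 mul0r.
Qed.

Lemma pairing0r u : chi u 0 = 1.
Proof.
have /eqP : chi u 0 * (chi u 0 - 1) = 0 by rewrite mulrBr mulr1 -chiDr addr0 subrr.
rewrite mulf_eq0 subr_eq0 => /orP[/eqP u0|/eqP//].
have : chi 0 0 = 0 by rewrite -{1}(subrr u) chiDl u0 mul0r.
by rewrite pairing0l => /eqP; rewrite oner_eq0.
Qed.

Lemma pairing_sum (I J : finType) (u : I -> V) (v : J -> V) :
  chi (\sum_i u i) (\sum_j v j) = \prod_j \prod_i chi (u i) (v j).
Proof.
rewrite (big_morph (chi (\sum_i u i)) (id1 := 1) (op1 := *%R)) //; last exact: pairing0r.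
apply: eq_bigr => j _.
by rewrite (big_morph (chi^~ (v j)) (id1 := 1) (op1 := *%R)) //; exact: pairing0l.
Qed.

(** The additive energy of order [k] of the family [u]: pairs of k-tuples with equal sums. *)
Definition collisions_sum k (I : finType) (u : I -> V) :=
  collisions (fun h : {ffun 'I_k -> I} => \sum_s u (h s)).

(** A first [power_step] over [j] turns [i] into (k+1)-tuples [h]; a second one over [h] turns [j]
    into (l+1)-tuples [g]. By bimultiplicativity the product of characters is the character at the
    two sums, and [bilinear_collisions] contributes the final exponent 2. *)
Lemma bilinear_sum_bound (I J : finType) (P : I -> C) (Q : J -> C)
    (u : I -> V) (v : J -> V) (a b : C) k l :
  0 <= a -> 0 <= b ->
  (forall i, `|P i| <= b) -> (forall j, `|Q j| <= a) ->
  `|\sum_j \sum_i Q j * P i * chi (u i) (v j)| ^+ (2 * k.+1 * l.+1) <=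
    (a * b) ^+ (2 * k.+1 * l.+1) * #|J|%:R ^+ (2 * k * l.+1) * #|I|%:R ^+ (2 * k.+1 * l)
    * (#|V|%:R * (collisions_sum k.+1 u)%:R * (collisions_sum l.+1 v)%:R).
Proof.
move=> a0 b0 Pb Qa; set S := \sum_j _.
have [Q' Q'1] := power_step P (fun i j => chi (u i) (v j)) k Qa; rewrite -/S.
set S1 := \sum_j _ => le1.
have P'b (h : {ffun 'I_k.+1 -> I}) : `|\prod_s P (h s)| <= b ^+ k.+1.
  rewrite normr_prod -[in leRHS](card_ord k.+1) -prodr_const.
  by apply: ler_prod => s _; rewrite normr_ge0 Pb.
have [P' P'1] := power_step Q' (fun j (h : {ffun 'I_k.+1 -> I}) =>
  \prod_s chi (u (h s)) (v j)) l P'b.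
have -> : \sum_(h : {ffun 'I_k.+1 -> I}) \sum_j
    (\prod_s P (h s)) * Q' j * (\prod_s chi (u (h s)) (v j)) = S1.
  rewrite exchange_big; apply: eq_bigr => j _; apply: eq_bigr => h _.
  by rewrite [Q' j * _]mulrC.
set S2 := \sum_h _ => le2.
have le3 : `|S2| ^+ 2 <= #|V|%:R * (collisions_sum k.+1 u)%:R * (collisions_sum l.+1 v)%:R.
  rewrite -/(S2); have -> : S2 = \sum_(h : {ffun 'I_k.+1 -> I}) \sum_(g : {ffun 'I_l.+1 -> J})
      P' h * (\prod_s Q' (g s)) * chi (\sum_s u (h s)) (\sum_s v (g s)).
    by apply: eq_bigr => h _; apply: eq_bigr => g _; rewrite pairing_sum.
  apply: bilinear_collisions => // g; rewrite normr_prod prodr_ile1 // => s.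
  by rewrite normr_ge0 Q'1.
have -> : (2 * k.+1 * l.+1 = k.+1 * l.+1 * 2)%N by ring.
have -> : (2 * k * l.+1 = k * l.+1 * 2)%N by ring.
have -> : (2 * k.+1 * l = k.+1 * l * 2)%N by ring.
set X := #|V|%:R * _ * _ in le3 *.
apply: (@le_trans _ _ (((a ^+ k.+1 * #|J|%:R ^+ k) ^+ l.+1 * `|S1| ^+ l.+1) ^+ 2)).
  rewrite -exprMn !exprM; do 2 (apply: lerXn2r; rewrite ?nnegrE ?exprn_ge0 ?mulr_ge0 ?exprn_ge0 //).
apply: (@le_trans _ _ (((a ^+ k.+1 * #|J|%:R ^+ k) ^+ l.+1 *
    ((b ^+ k.+1) ^+ l.+1 * (#|I|%:R ^+ k.+1) ^+ l * `|S2|)) ^+ 2)).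
  apply: lerXn2r; rewrite ?nnegrE ?mulr_ge0 ?exprn_ge0 ?mulr_ge0 ?exprn_ge0 //.
  rewrite ler_wpM2l ?exprn_ge0 ?mulr_ge0 ?exprn_ge0 //; apply: le_trans le2 _.
  by rewrite card_ffun card_ord natrX.
rewrite !exprMn -!exprM !mulnA.
apply: le_trans (_ : a ^+ (k.+1 * l.+1 * 2) * #|J|%:R ^+ (k * l.+1 * 2) *
  (b ^+ (k.+1 * l.+1 * 2) * #|I|%:R ^+ (k.+1 * l * 2) * X) <= _).
  do 2 (apply: ler_wpM2l; first by rewrite mulr_ge0 ?exprn_ge0).
  exact: le3.
by rewrite le_eqVlt; apply/orP; left; apply/eqP; ring.
Qed.

End Pairing.
End BilinearSums.

(** * Additive characters modulo F *)

Section UnitCircle.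
Variable R : realType.
Implicit Types x y : R.

Definition cis x : R[i] := (cos x +i* sin x)%C.

Lemma cisD x y : cis (x + y) = cis x * cis y.
Proof.
by rewrite /cis cosD sinD; apply/eqP; rewrite eq_complex /= eqxx addrC mulrC [X in _ + X]mulrC eqxx.
Qed.

Lemma cis0 : cis 0 = 1.
Proof. by rewrite /cis cos0 sin0. Qed.

Lemma norm_cis x : `|cis x| = 1.
Proof. by rewrite normc_def /= cos2Dsin2 sqrtr1. Qed.

Lemma cisM x n : cis (x * n%:R) = cis x ^+ n.
Proof.
elim: n => [|n IHn]; first by rewrite mulr0 cis0.
by rewrite exprS -natr1 mulrDr mulr1 cisD IHn mulrC.
Qed.

Lemma cis_root p : (0 < p)%N -> cis (2 * pi / p%:R) ^+ p = 1.
Proof.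
move=> p0; rewrite -cisM divfK ?pnatr_eq0 -?lt0n // mulr_natl.
by rewrite /cis cos2pi sin2pi.
Qed.

Lemma cis_neq1 x : 0 < x < 2 * pi -> cis x != 1.
Proof.
move=> /andP[x0 x2]; apply/eqP => -[c1 _].
have s0 : 0 < sin (x / 2) by apply: sin_gt0_pi; apply/andP; split; lra.
move: c1 (exprn_gt0 2 s0); have {1}-> : x = x / 2 + x / 2 by lra.
by rewrite cosD -!expr2 cos2sin2; move: (sin _ ^+ 2) => z; lra.
Qed.

End UnitCircle.

(** By linear independence of automorphisms, their combination with all coefficients 1 is not
    identically zero. *)
Lemma galTrace_neq0 (F : fieldType) (L : splittingFieldType F) (E M : {subfield L}) :
  exists2 a, a \in M & galTrace E M a != 0.
Proof.
have [a aM Ta] := @gal_independent_contra _ _ M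
  [in 'Gal(M / E)%g] (fun=> 1) 1%g (group1 _) (oner_neq0 _).
by exists a => //; rewrite /galTrace; under eq_bigr do rewrite -[_ a]mul1r.
Qed.

Section Characters.
Variables (R : realType) (p : nat) (K : finFieldType).
Variable pcharK : p \in [pchar K].
Implicit Types x y F : {poly K}.
Local Notation L := (pPrimeCharType pcharK).
Local Notation Tr := (abs_trace pcharK).
Local Notation zeta := (cis (2 * pi / p%:R) : R[i]).

Let p_pr : prime p. Proof. exact: pcharf_prime pcharK. Qed.

Lemma abs_traceD (c d : K) : Tr (c + d) = Tr c + Tr d.
Proof. by rewrite /abs_trace raddfD /= linearD. Qed.

Lemma abs_trace_neq0 : exists c : K, Tr c != 0.
Proof.
have [a _ Ta] := galTrace_neq0 1%AS {: L}%AS.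
exists a; apply: contraNneq Ta => T0.
by rewrite -abs_traceP T0.
Qed.

Lemma val_FpD (s t : 'F_p) : (s + t : 'F_p) = ((s + t) %% p)%N :> nat.
Proof. by congr (_ %% _)%N; apply: Fp_cast. Qed.

Definition Fp_char (s : 'F_p) : R[i] := zeta ^+ s.

Lemma Fp_charD s t : Fp_char (s + t) = Fp_char s * Fp_char t.
Proof.
by rewrite /Fp_char val_FpD (expr_mod _ (cis_root _ (prime_gt0 p_pr))) exprD.
Qed.

Lemma norm_Fp_char s : `|Fp_char s| = 1.
Proof. by rewrite normrX norm_cis expr1n. Qed.

Lemma Fp_char_neq1 s : s != 0 -> Fp_char s != 1.
Proof.
move=> s0; rewrite /Fp_char -cisM cis_neq1 //.
have lt_sp : (s < p)%N by rewrite -[X in (_ < X)%N](Fp_cast p_pr) ltn_ord.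
have s_gt0 : (0 < s)%N by rewrite lt0n.
have pi0 := @pi_gt0 R; have p0 : 0 < p%:R :> R by rewrite ltr0n prime_gt0.
apply/andP; split; first by apply: mulr_gt0; rewrite ?ltr0n // divr_gt0 // mulr_gt0.
by rewrite mulrAC ltr_pdivrMr // ltr_pM2l ?mulr_gt0 // ltr_nat.
Qed.

Lemma echar_modE F x : echar_mod R pcharK F x = Fp_char (Tr ((x * 'X) %/ F)`_0).
Proof. by rewrite /Fp_char -cisM. Qed.

Lemma echar_modD F x y : echar_mod R pcharK F (x + y)
  = echar_mod R pcharK F x * echar_mod R pcharK F y.
Proof. by rewrite !echar_modE mulrDl divpD coefD abs_traceD Fp_charD. Qed.

Lemma norm_echar_mod F x : `|echar_mod R pcharK F x| = 1.
Proof. by rewrite echar_modE norm_Fp_char. Qed.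

Lemma echar_mod0 F : echar_mod R pcharK F 0 = 1.
Proof.
have : echar_mod R pcharK F 0 * (echar_mod R pcharK F 0 - 1) = 0.
  by rewrite mulrBr mulr1 -echar_modD addr0 subrr.
move/eqP; rewrite mulf_eq0 subr_eq0 => /orP[/eqP e0|/eqP//].
by have := norm_echar_mod F 0; rewrite e0 normr0 => /eqP; rewrite eq_sym oner_eq0.
Qed.

Lemma echar_mod_dvd F x : F %| x -> echar_mod R pcharK F x = 1.
Proof.
have [->|F0] := eqVneq F 0; first by rewrite dvd0p => /eqP->; rewrite echar_mod0.
move=> /dvdpP[y ->]; rewrite -[RHS](echar_mod0 F) !echar_modE mul0r div0p coef0.
by rewrite mulrAC mulpK // coefMX.
Qed.

Lemma echar_mod_cong F x y : F %| x - y -> echar_mod R pcharK F x = echar_mod R pcharK F y.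
Proof.
by move=> Fxy; rewrite -[x](subrK y) echar_modD (echar_mod_dvd Fxy) mul1r.
Qed.

Lemma conj_echar_mod F x : (echar_mod R pcharK F x)^* = echar_mod R pcharK F (- x).
Proof.
have e0 : echar_mod R pcharK F x != 0 by rewrite -normr_eq0 norm_echar_mod oner_neq0.
apply: (mulfI e0); rewrite -normCK norm_echar_mod expr1n -echar_modD subrr.
by rewrite echar_mod0.
Qed.

Lemma echar_mod_nontrivial F x : F != 0 -> ~~ (F %| x) ->
  exists u : {poly_(size F).-1 K}, echar_mod R pcharK F (polyn u * x) != 1.
Proof.
move=> F0 nFx; pose y : {poly K} := x %% F.
have y0 : y != 0 by [].
have sy : (size y < size F)%N by apply: ltn_modpN0.
have [c Tc] := abs_trace_neq0.
(* The degree of [u] is chosen so that u y T has the degree of [F], and its coefficient so that the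
   quotient by [F] is exactly the constant [c] of nonzero trace. *)
pose j := ((size F).-1 - size y)%N.
have sF : (0 < size F)%N by rewrite size_poly_gt0.
have lcy : lead_coef y != 0 by rewrite lead_coef_eq0.
have lcF : lead_coef F != 0 by rewrite lead_coef_eq0.
pose u : {poly K} := (c * lead_coef F / lead_coef y) *: 'X^j.
have su : (size u <= (size F).-1)%N.
  apply: leq_trans (size_scale_leq _ _) _; rewrite size_polyXn /j.
  by have : (0 < size y)%N; [rewrite size_poly_gt0 | lia].
exists (npolyp _ u); rewrite npolypK //.
have -> : echar_mod R pcharK F (u * x) = echar_mod R pcharK F (u * y).
  by apply: echar_mod_cong; rewrite -mulrBr /y {1}(divp_eq x F) addrK mulrA dvdp_mull.
rewrite echar_modE; suff -> : ((u * y * 'X) %/ F)`_0 = c by apply: Fp_char_neq1.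
pose w : {poly K} := y * 'X^(j.+1).
have -> : u * y * 'X = (c * lead_coef F / lead_coef y) *: w.
  by rewrite /u /w -!scalerAl exprSr mulrA [_ * y]mulrC.
have sw : size w = size F.
  have X0 : ('X^(j.+1) : {poly K}) != 0 by rewrite monic_neq0 ?monicXn.
  rewrite /w size_mul // size_polyXn addnS /= /j.
  have y_gt0 : (0 < size y)%N by rewrite size_poly_gt0.
  by move: sy y_gt0; move: (size y) (size F) => b c'; clear; lia.
have lw : lead_coef w = lead_coef y by rewrite lead_coef_Mmonic ?monicXn.
rewrite divpZl coefZ.
have sq : (size (w %/ F)%R <= 1)%N by rewrite size_divp // sw; move: (size F) => b; clear; lia.
have := congr1 lead_coef (divp_eq w F); rewrite lw (size1_polyC sq) mul_polyC.
have q0 : (w %/ F)`_0 != 0.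
  rewrite -polyC_eq0 -(size1_polyC sq) divpN0 // sw //.
rewrite lead_coefDl ?lead_coefZ; last by rewrite size_scale // ltn_modpN0.
move=> ->; move: (_`_0) q0 => z z0; rewrite coefC /=.
by field; rewrite lcF.
Qed.

Definition pairing F a (u v : {poly_(size F).-1 K}) : R[i] :=
  echar_mod R pcharK F (a * (polyn u * polyn v)).

Lemma pairingDl F a (u u' v : {poly_(size F).-1 K}) :
  pairing a (u + u') v = pairing a u v * pairing a u' v.
Proof. by rewrite /pairing -echar_modD -mulrDr -mulrDl. Qed.

Lemma pairingDr F a (u v v' : {poly_(size F).-1 K}) :
  pairing a u (v + v') = pairing a u v * pairing a u v'.
Proof. by rewrite /pairing -echar_modD -mulrDr -mulrDr. Qed.

(** For v and v' distinct, their difference is nonzero and shorter than [F], so some shift [u0] has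
    character value different from 1. Translating the summation variable by [u0] multiplies the sum
    by that value, so the sum vanishes. *)
Lemma pairing_orth F a (v v' : {poly_(size F).-1 K}) : F != 0 -> coprimep a F ->
  \sum_u pairing a u v * (pairing a u v')^* =
    #|{poly_(size F).-1 K}|%:R *+ (v == v').
Proof.
move=> F0 aF; pose w : {poly K} := polyn v - polyn v'.
have -> : \sum_u pairing a u v * (pairing a u v')^* =
    \sum_(u : {poly_(size F).-1 K}) echar_mod R pcharK F (polyn u * (a * w)).
  apply: eq_bigr => u _; rewrite /pairing conj_echar_mod -echar_modD.
  by congr echar_mod; rewrite /w; ring.
have [eqv|vv'] := eqVneq v v'.
  rewrite /w eqv subrr; under eq_bigr do rewrite !mulr0 echar_mod0.
  by rewrite sumr_const mulr1n.
have [|u0 eu0] := @echar_mod_nontrivial F (a * w) F0.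
  rewrite Gauss_dvdpr 1?coprimep_sym //; apply: contra vv' => Fw.
  rewrite -val_eqE /= -subr_eq0 -/w; apply: contraTT Fw => w0.
  apply/negP => /(dvdp_leq w0); apply/negP; rewrite -ltnNge.
  rewrite (leq_ltn_trans (size_polyD _ _)) // size_polyN gtn_max.
  by rewrite -{2 4}(prednK (_ : 0 < size F)%N) ?size_poly_gt0 // !ltnS !size_npoly.
set S := \sum_u _; apply/eqP; rewrite mulr0n.
have : S * (echar_mod R pcharK F (polyn u0 * (a * w)) - 1) = 0.
  apply/eqP; rewrite mulrBr mulr1 subr_eq0 {2}/S (reindex_inj (addrI u0)) /= mulr_suml.
  by apply/eqP/eq_bigr => u _; rewrite -echar_modD -mulrDl addrC.
by move=> /eqP; rewrite mulf_eq0 subr_eq0 (negPf eu0) orbF.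
Qed.

End Characters.

(** * Bounds for the number of congruences *)

Section DivisorBound.
Variables (R : realType) (K : finFieldType).
Local Notation Q := (#|K|%:R : R).

Lemma Q_gt1 : 1 < Q.
Proof. by rewrite ltr1n q_gt1. Qed.

Lemma Q_gt0 : 0 < Q.
Proof. exact: lt_trans Q_gt1. Qed.

Lemma powR_Q_gt0 (x : R) : 0 < Q `^ x.
Proof. by rewrite powR_gt0 // Q_gt0. Qed.

Lemma powR_QD (x y : R) : Q `^ (x + y) = Q `^ x * Q `^ y.
Proof. by rewrite powRD //; apply/implyP => _; rewrite lt0r_neq0 // Q_gt0. Qed.

Lemma powR_QX (x : R) n : (Q `^ x) ^+ n = Q `^ (x * n%:R).
Proof. by rewrite -powR_mulrn ?powR_ge0 // powRrM. Qed.

Lemma ler_powR_Q (x y : R) : x <= y -> Q `^ x <= Q `^ y.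
Proof. by move=> xy; rewrite ler_powR // ltW // Q_gt1. Qed.

Lemma powR_Q_ge1 (x : R) : 0 <= x -> 1 <= Q `^ x.
Proof. by move=> x0; rewrite -[leLHS](powRr0 Q) ler_powR_Q. Qed.

Lemma natX_powR_Q n : (#|K| ^ n)%:R = Q `^ n%:R :> R.
Proof. by rewrite natrX powR_mulrn // ltW // Q_gt0. Qed.

Lemma linear_le_exp (b : R) s : 1 < b -> s%:R <= (b - 1)^-1 * b ^+ s.
Proof.
move=> b1; rewrite mulrC ler_pdivlMr ?subr_gt0 //.
elim: s => [|s IHs]; first by rewrite mul0r.
rewrite -natr1 mulrDl mul1r exprS.
have : 1 <= b ^+ s by rewrite exprn_ege1 // ltW.
by move: (b ^+ s) IHs => y IHs y1; nra.
Qed.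

(** The divisor bound, deduced from [ndiv_le] with fixed [L]: the power s^(q^L) of the size and the
    factor 2^(s/L) each receive half of the exponent e s. *)
Lemma ndiv_bound (e : R) : 0 < e ->
  exists2 c : R, 0 < c & forall X : {poly K}, X != 0 ->
    (ndiv X)%:R <= c * Q `^ (e * (size X)%:R).
Proof.
move=> e0; pose L := (Num.truncn (2 / e)).+1.
have L0 : 0 < L%:R :> R by rewrite ltr0n.
have leL : 2 / e < L%:R by rewrite /L truncnS_gt.
pose A := (#|K| ^ L)%N; have A0 : (0 < A)%N by rewrite expn_gt0 ltnW ?q_gt1.
(* With this base, (b^s)^A is exactly Q^(e s / 2), and b > 1 lets [linear_le_exp] bound s by a
   multiple of b^s. *)
pose b : R := Q `^ (e / 2 / A%:R).
have b1 : 1 < b.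
  have eA : 0 < e / 2 / A%:R by rewrite !divr_gt0 ?ltr0n.
  have := gt0_ltr_powR eA (x := 1) (y := Q).
  by rewrite !nnegrE ler01 (ltW Q_gt0) powR1 => /(_ isT isT Q_gt1).
exists ((b - 1)^-1 ^+ A * Q) => [|X X0].
  by rewrite mulr_gt0 ?Q_gt0 // exprn_gt0 // invr_gt0 subr_gt0.
have [D leX leD] := ndiv_le L X0; set s := size X in leX leD *.
have sA : (s ^ A)%:R <= (b - 1)^-1 ^+ A * Q `^ (e / 2 * s%:R) :> R.
  have -> : Q `^ (e / 2 * s%:R) = (b ^+ s) ^+ A.
    rewrite /b !powR_QX; congr (_ `^ _); field.
    by rewrite pnatr_eq0 -lt0n.
  rewrite natrX -exprMn lerXn2r ?nnegrE // ?linear_le_exp //.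
  by rewrite mulr_ge0 ?exprn_ge0 ?invr_ge0 ?subr_ge0 ?(ltW b1) // (le_trans _ (ltW b1)).
have leD' : D%:R <= Q * Q `^ (e / 2 * s%:R).
  rewrite -(@ler_pXn2r _ L) ?nnegrE ?mulr_ge0 ?powR_ge0 ?(ltW Q_gt0) //.
  have : (D ^ L)%:R <= (#|K| ^ L * 2 ^ s)%:R :> R by rewrite ler_nat.
  rewrite natrX => /le_trans; apply; rewrite natrM exprMn natrX.
  rewrite ler_wpM2l ?exprn_ge0 ?(ltW Q_gt0) //.
  apply: le_trans (_ : (#|K| ^ s)%:R <= _); first by rewrite ler_nat leq_expl ?q_gt1.
  rewrite natX_powR_Q powR_QX ler_powR_Q // mulrAC ler_peMl //.
  by move: leL; rewrite ltr_pdivrMr // => ?; lra.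
have -> : e * s%:R = e / 2 * s%:R + e / 2 * s%:R by lra.
rewrite powR_QD; apply: le_trans (_ : (s ^ A * D)%:R <= _); first by rewrite ler_nat.
by rewrite natrM [leRHS]mulrACA ler_pM.
Qed.

Definition max_ndiv s := (\max_(X : {poly_s K} | polyn X != 0%R) ndiv (polyn X))%N.

Lemma ndiv_le_max s (X : {poly K}) : X != 0 -> (size X <= s)%N -> (ndiv X <= max_ndiv s)%N.
Proof.
move=> X0 sX; rewrite /max_ndiv.
by have := @leq_bigmax_cond _ (fun X : {poly_s K} => polyn X != 0)
  (fun X => ndiv (polyn X)) (npolyp s X); rewrite npolypK //; apply.
Qed.

Lemma max_ndiv_bound (e : R) : 0 < e ->
  exists2 c : R, 1 <= c & forall s, (max_ndiv s)%:R <= c * Q `^ (e * s%:R).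
Proof.
move=> e0; have [c c0 cP] := ndiv_bound e0; exists (c + 1) => [|s]; first by lra.
rewrite /max_ndiv; elim/big_ind: _ => [|x y lex ley|X X0].
- by rewrite mulr_ge0 ?powR_ge0 //; lra.
- by case: (leqP x y).
apply: le_trans (cP _ X0) _; rewrite ler_pM ?powR_ge0 ?(ltW c0) //; first by lra.
by rewrite ler_powR_Q // ler_wpM2l ?(ltW e0) // ler_nat size_npoly.
Qed.

End DivisorBound.

(** * From equal sums of inverses to congruences *)

Section InverseResidues.
Variables (K : finFieldType) (F : {poly K}).
Hypothesis F0 : F != 0.
Local Notation q := #|K|.
Local Notation r := (size F).-1.
Local Notation units n := {x : {poly_n K} | x \in [pred x | coprimep (polyn x) F]}.

Lemma size_inv_mod x : (size (inv_mod F x) <= r)%N.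
Proof.
by rewrite /inv_mod; case: pickP => [y _|_]; rewrite ?size_npoly ?size_poly0.
Qed.

Lemma dvd_inv_mod x : coprimep x F -> F %| x * inv_mod F x - 1.
Proof. by move=> xF; rewrite /dvdp modpD modpN inv_modP // subrr. Qed.

Definition inv_res n (x : units n) : {poly_r K} := npolyp r (inv_mod F (polyn (val x))).

Lemma polyn_inv_res n (x : units n) : polyn (inv_res x) = inv_mod F (polyn (val x)).
Proof. by rewrite /inv_res npolypK // size_inv_mod. Qed.

Lemma inv_mod_mul x y : coprimep x F -> coprimep y F ->
  F %| inv_mod F (x * y) - inv_mod F x * inv_mod F y.
Proof.
move=> xF yF; have xyF : coprimep (x * y) F by rewrite coprimepMl xF.
rewrite -(Gauss_dvdpr _ (_ : coprimep F (x * y))) 1?coprimep_sym //.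
have -> : x * y * (inv_mod F (x * y) - inv_mod F x * inv_mod F y) =
   (x * y * inv_mod F (x * y) - 1) - (x * inv_mod F x - 1) * (y * inv_mod F y)
   - (y * inv_mod F y - 1) by ring.
by apply: dvdp_sub; [apply: dvdp_sub; [|apply: dvdp_mulr]|]; apply: dvd_inv_mod.
Qed.

(** When y_i inverts x_i modulo [F], multiplying y_i by the full denominator cancels x_i and leaves
    the product of the other factors. *)
Lemma recip_num_inv (I : finType) (x y : I -> {poly K}) :
  (forall i, F %| x i * y i - 1) -> F %| recip_den x * (\sum_i y i) - recip_num x.
Proof.
move=> xy; rewrite mulr_sumr /recip_num -sumrB.
apply: (big_ind (fun z : {poly K} => F %| z)) => [|u v|i _]; [exact: dvdp0|exact: dvdp_add|].
rewrite /recip_den (bigD1 i) //=.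
have -> : x i * \prod_(j | j != i) x j * y i - \prod_(j | j != i) x j
   = \prod_(j | j != i) x j * (x i * y i - 1) by ring.
exact: dvdp_mull.
Qed.

Lemma recip_cong_inv (I J : finType) (x y : I -> {poly K}) (x' y' : J -> {poly K}) :
  (forall i, F %| x i * y i - 1) -> (forall j, F %| x' j * y' j - 1) ->
  \sum_i y i = \sum_j y' j ->
  F %| recip_num x * recip_den x' - recip_num x' * recip_den x.
Proof.
move=> /recip_num_inv xy /recip_num_inv xy' eqy.
have -> : recip_num x * recip_den x' - recip_num x' * recip_den x =
   recip_den x * (recip_den x' * (\sum_j y' j) - recip_num x')
   - recip_den x' * (recip_den x * (\sum_i y i) - recip_num x) by rewrite eqy; ring.
by rewrite dvdp_sub // dvdp_mull.
Qed.

Lemma collisions_le_recip_cong k n :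
  (collisions_sum k (@inv_res n.+1) <= #|recip_cong k n F|)%N.
Proof.
apply: (card_le_inj (r := fun (h : {ffun 'I_k -> units n.+1} * {ffun 'I_k -> units n.+1})
   (p : {ffun 'I_k -> {poly_(n.+1) K}} * {ffun 'I_k -> {poly_(n.+1) K}}) =>
   [forall i, p.1 i == val (h.1 i)] && [forall i, p.2 i == val (h.2 i)])).
  move=> [h h'] /eqP /= /(congr1 (@polyn K r)); rewrite !raddf_sum /= => eqh.
  exists ([ffun i => val (h i)], [ffun i => val (h' i)]); last first.
    by apply/andP; split; apply/forallP => i; rewrite ffunE.
  have hF (g : {ffun 'I_k -> units n.+1}) i : coprimep (npol [ffun i => val (g i)] i) F.
    by rewrite /npol ffunE; apply: (valP (g i)).
  apply/and3P; split; [exact/forallP/hF | exact/forallP/hF |].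
  have inv (g : {ffun 'I_k -> units n.+1}) i :
      F %| npol [ffun i => val (g i)] i * polyn (inv_res (g i)) - 1.
    by rewrite polyn_inv_res /npol ffunE; apply: dvd_inv_mod; apply: (valP (g i)).
  exact: recip_cong_inv (inv h) (inv h') eqh.
move=> [h h'] [g g'] [x x'] _ _ /andP[/= /forallP xh /forallP xh'] /andP[/forallP xg /forallP xg'].
congr (_, _); apply/ffunP => i; apply/val_inj.
  exact: etrans (esym (eqP (xh i))) (eqP (xg i)).
exact: etrans (esym (eqP (xh' i))) (eqP (xg' i)).
Qed.

(** Equal inverses force x' - x = F d with d of size at most n - r. For n <= r the truncated
    difference is 0, leaving only x' = x. *)
Lemma collisions_one n : (collisions_sum 1 (@inv_res n) <= q ^ (n + (n - r)))%N.
Proof.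
rewrite expnD -!card_npoly -card_prod.
apply: (card_le_inj (r := fun (h : {ffun 'I_1 -> units n} * {ffun 'I_1 -> units n})
   (p : {poly_n K} * {poly_(n - r) K}) =>
   (p.1 == val (h.1 ord0)) && (polyn (val (h.2 ord0)) - polyn (val (h.1 ord0)) == F * polyn p.2))).
  move=> [h h'] /eqP /= /(congr1 (@polyn K r)).
  rewrite !big_ord1 !polyn_inv_res; move: (h ord0) (h' ord0) => x x' eqx.
  have /dvdp_factor[d dE] : F %| polyn (val x') - polyn (val x).
    have -> : polyn (val x') - polyn (val x) =
       polyn (val x) * (polyn (val x') * inv_mod F (polyn (val x')) - 1)
       - (polyn (val x) * inv_mod F (polyn (val x)) - 1) * polyn (val x') by rewrite eqx; ring.
    by apply: dvdp_sub; [apply: dvdp_mull | apply: dvdp_mulr]; apply: dvd_inv_mod;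
      [exact: (valP x') | exact: (valP x)].
  have sd : (size d <= n - r)%N.
    have [->|d0] := eqVneq d 0; first by rewrite size_poly0.
    have : (size (F * d)%R <= n)%N.
      by rewrite -dE (leq_trans (size_polyD _ _)) // size_polyN geq_max !size_npoly.
    move: (sizeM F0 d0) (size_gt0 F0) (size_gt0 d0).
    by move: (size F) (size d) (size (F * d)) => a b c; clear; lia.
  exists (val x, npolyp (n - r) d); rewrite // eqxx npolypK //=.
  by rewrite dE.
move=> [h h'] [g g'] [x d] _ _ /andP[/= /eqP xh /eqP dh] /andP[/eqP xg /eqP dg].
have eqhg : h ord0 = g ord0 by apply/val_inj; exact: etrans (esym xh) xg.
congr (_, _); apply/ffunP => i; rewrite (ord1 i) //; apply/val_inj/val_inj.
apply: (addIr (- polyn (val (h ord0)))); apply: etrans dh _.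
by rewrite eqhg; apply: etrans (esym dg) _.
Qed.

End InverseResidues.

(** * Energy estimates with real exponents *)

Section EnergyBounds.
Variables (R : realType) (K : finFieldType).
Implicit Type F : {poly K}.
Local Notation Q := (#|K|%:R : R).
Local Notation energy k F n := ((collisions_sum k (@inv_res K F n))%:R : R).

(** The hypotheses on [k] say that k + 1 is the least order with 2(k + 1)n >= deg F. Bounding [k] by
    [K0] makes the constant uniform, since the divisor bound is raised to the power 2(k + 1). *)
Lemma large_energy_bound K0 (e : R) : 0 < e ->
  exists2 c : R, 1 <= c & forall F n k, (k < K0)%N -> (0 < k)%N -> (0 < n)%N ->
    (2 * (k * n) < (size F).-1)%N -> ((size F).-1 <= 2 * (k.+1 * n))%N ->
    energy k.+1 F n <= c * Q `^ ((2 * (k.+1 * n))%:R - (size F).-1%:R / 2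
                                 + e * (size F).-1%:R).
Proof.
(* At most 2(K0 + 1) divisor factors occur, each at sizes up to 4r, so the total loss is 8(K0 + 1)
   e' r = e r. *)
move=> e0; pose e' : R := e / (8 * K0.+1%:R).
have K0_gt0 : 0 < K0.+1%:R :> R by rewrite ltr0n.
have e'0 : 0 < e' by rewrite divr_gt0 // mulr_gt0.
have [c c1 cP] := max_ndiv_bound K e'0.
have c0 : 0 <= c by lra.
exists (4 * (c ^+ (2 * K0.+1) * Q)) => [|F n k kK0 k0 n0 kn_lt kn_ge].
  have : 1 <= c ^+ (2 * K0.+1) * Q by rewrite mulr_ege1 ?exprn_ege1 // ltW // Q_gt1.
  by move: (_ * Q) => y; lra.
move: n n0 kn_lt kn_ge => [//|N] _; set n := N.+1; set r := (size F).-1 => kn_lt kn_ge.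
have r0 : (0 < r)%N by lia.
have sF : (1 < size F)%N by rewrite /r in r0; move: r0; clear; case: (size F) => [|[]].
have F0 : F != 0 by rewrite -size_poly_gt0 ltnW.
pose s := (3 * (k.+1 * N)).+1.
have s4 : (s <= 4 * r)%N by rewrite /s; move: kn_lt k0 r0; rewrite /n; clear; nia.
(* The two terms of [card_recip_cong], with exponents doubled to avoid halves: the first inequality
   uses r <= 2(k + 1)n, the second 2kn < r. *)
have [le1 le2] : (2 * ((k.+1 * N).+1 + r) <= 4 * (k.+1 * n) + r + 2)%N /\
    (2 * (k.+1 * n + (k * N + k.+1 * N).+2) <= 4 * (k.+1 * n) + r + 2)%N.
  by move: kn_lt kn_ge k0; rewrite /n; clear; nia.
have tau_le : (max_ndiv K s)%:R ^+ (k.+1 + k.+1) <= c ^+ (2 * K0.+1) * Q `^ (e * r%:R).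
  set b : R := c * Q `^ (e' * (4 * r)%:R).
  have b1 : 1 <= b.
    rewrite mulr_ege1 // powR_Q_ge1 //.
    by rewrite mulr_ge0 // ltW.
  apply: le_trans (_ : b ^+ (2 * K0.+1) <= _).
    apply: le_trans (_ : b ^+ (k.+1 + k.+1) <= _); last first.
      by apply: ler_weXn2l => //; lia.
    have b0 : 0 <= b by apply: le_trans b1.
    rewrite lerXn2r ?nnegrE //; apply: le_trans (cP s) _.
    by rewrite /b ler_wpM2l // ler_powR_Q // ler_wpM2l ?(ltW e'0) // ler_nat.
  rewrite /b exprMn powR_QX ler_wpM2l ?exprn_ge0 // ler_powR_Q //.
  rewrite !natrM /e'; move: K0_gt0; move: (K0.+1%:R : R) => x x0.
  by rewrite le_eqVlt; apply/orP; left; apply/eqP; field; rewrite gt_eqF.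
have := card_recip_cong (@ndiv_le_max K s) (ltnSn _) sF; rewrite -/r -/n.
set E := #|_| => leE.
have {}leE : (E * #|K| ^ r)%:R <= 4 * (max_ndiv K s)%:R ^+ (k.+1 + k.+1) *
    Q `^ ((2 * (k.+1 * n))%:R + r%:R / 2 + 1) :> R.
  have exp_le A : (2 * A <= 4 * (k.+1 * n) + r + 2)%N ->
      (#|K| ^ A)%:R <= Q `^ ((2 * (k.+1 * n))%:R + r%:R / 2 + 1).
    rewrite natX_powR_Q => leA; rewrite ler_powR_Q //.
    have : (2 * A)%:R <= (4 * (k.+1 * n) + r + 2)%:R :> R by rewrite ler_nat.
    by rewrite !natrD !natrM; lra.
  move: (exp_le _ le1) (exp_le _ le2); move: (Q `^ ((2 * _)%:R + _ + 1)) => z z1 z2.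
  move: leE; rewrite -(ler_nat R) => /le_trans; apply; rewrite !natrM natrD natrX.
  have t0 : 0 <= (max_ndiv K s)%:R ^+ (k.+1 + k.+1) :> R by rewrite exprn_ge0.
  move: (_ ^+ _) t0 z1 z2 => t t0; move: (_%:R) (_%:R) => x y; nra.
have E0 : 0 <= Q `^ r%:R by rewrite powR_ge0.
have le_coll : energy k.+1 F n <= E%:R by rewrite ler_nat; apply: collisions_le_recip_cong.
apply: le_trans le_coll _; rewrite -(ler_pM2r (powR_Q_gt0 K r%:R)).
rewrite natrM natX_powR_Q in leE; apply: le_trans leE _.
rewrite -!mulrA; rewrite ler_pM2l //.
have -> : c ^+ (2 * K0.+1) * (Q * (Q `^ ((2 * (k.+1 * n))%:R - r%:R / 2 + e * r%:R) * Q `^ r%:R))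
   = c ^+ (2 * K0.+1) * Q `^ (e * r%:R) * Q `^ ((2 * (k.+1 * n))%:R + r%:R / 2 + 1).
  set x := _ - _ / 2 + _.
  have -> : Q * (Q `^ x * Q `^ r%:R) = Q `^ (1 + (x + r%:R)).
    by rewrite !powR_QD powRr1 // ltW // Q_gt0.
  by rewrite -[RHS]mulrA -powR_QD; congr (_ * _ `^ _); rewrite /x; lra.
by rewrite ler_wpM2r ?powR_ge0.
Qed.

Lemma trivial_energy_bound F n : F != 0 ->
  energy 1 F n <= Q `^ (n%:R + (n - (size F).-1)%:R).
Proof. by move=> F0; rewrite -natrD -natX_powR_Q ler_nat collisions_one. Qed.

(** The exponent [d] is the half of 3n - r, rounded down, plus one, which meets the hypothesis of
    [card_recip_cong2]; the extra one is paid for by the factor Q. Truncation at 0 covers 3n <= r,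
    where the main term is Q^(2n). *)
Lemma quadruple_energy_bound (e : R) : 0 < e ->
  exists2 c : R, 1 <= c & forall F n, (0 < n)%N -> (n <= (size F).-1)%N ->
    energy 2 F n <= c * Q `^ ((2 * n)%:R + (3 * n - (size F).-1)%:R / 2
                             + e * (size F).-1%:R).
Proof.
move=> e0; pose e' : R := e / 4; have e'0 : 0 < e' by rewrite divr_gt0.
have [c c1 cP] := max_ndiv_bound K e'0.
have c0 : 0 <= c by lra.
exists (6 * c * Q) => [|F n n0 n_le].
  by have := Q_gt1 R K; nra.
move: n n0 n_le => [//|N] _; set n := N.+1; set r := (size F).-1 => n_le.
have sF : (N.+2 <= size F)%N.
  by move: n_le; rewrite /n /r; clear; case: (size F) => [|f] //=; lia.
have F0 : F != 0 by rewrite -size_poly_gt0; apply: leq_trans sF.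
have sr : size F = r.+1 by rewrite /r prednK // size_poly_gt0.
pose d := ((3 * n - r)./2).+1; pose s := (2 * (size F + N))%N.
have large_d : (3 * N < 2 * d + (size F).-1)%N by rewrite -/r /d /n; clear; lia.
have s4 : (s <= 4 * r)%N by rewrite /s sr; move: n_le; rewrite /n; clear; lia.
have := card_recip_cong2 sF (@ndiv_le_max K s) (leqnn _) large_d.
set E := #|_| => leE.
have le_coll : energy 2 F n <= E%:R by rewrite ler_nat; apply: collisions_le_recip_cong.
apply: le_trans le_coll _.
move: leE; rewrite -(ler_nat R) => /le_trans; apply; rewrite natrM natX_powR_Q natrM natrD.
have powe : 1 <= Q `^ (e * r%:R).
  by rewrite powR_Q_ge1 // mulr_ge0 // ltW.
have tau_le : (max_ndiv K s)%:R <= c * Q `^ (e * r%:R).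
  apply: le_trans (cP s) _; rewrite ler_wpM2l // ler_powR_Q // /e'.
  have : s%:R <= (4 * r)%:R :> R by rewrite ler_nat.
  by rewrite natrM => ?; nra.
have pow_le : Q `^ (2 * n + d)%:R <= Q `^ ((2 * n)%:R + (3 * n - r)%:R / 2 + 1).
  rewrite ler_powR_Q // natrD -addrA lerD2l /d -natr1 lerD2r.
  by rewrite ler_pdivlMr // -natrM ler_nat; lia.
have -> : 6 * c * Q * Q `^ ((2 * n)%:R + (3 * n - r)%:R / 2 + e * r%:R) =
    6 * (c * Q `^ (e * r%:R)) * Q `^ ((2 * n)%:R + (3 * n - r)%:R / 2 + 1).
  rewrite !powR_QD powRr1 ?(ltW (Q_gt0 R K)) //; ring.
apply: ler_pM; rewrite ?powR_ge0 ?mulr_ge0 ?addr_ge0 //.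
by move: tau_le powe c1; move: (_%:R) (_ `^ _) => t z; nra.
Qed.

End EnergyBounds.

(** * Choice of the moments and the bilinear estimate *)

Section MainEstimate.
Variables (R : realType) (K : finFieldType).
Implicit Type F : {poly K}.
Local Notation Q := (#|K|%:R : R).
Local Notation energy k F n := ((collisions_sum k (@inv_res K F n))%:R : R).

(** The order is the least [k] with r <= 2(k + 1)n, and n >= r eps bounds it in terms of eps alone.
    For k = 0 one has 2n >= r and the trivial bound already suffices. *)
Lemma energy_short (eps e : R) : 0 < eps -> 0 < e ->
  exists K0 : nat, exists2 c : R, 1 <= c & forall F n, F != 0 -> (0 < n)%N ->
    (size F).-1%:R * eps <= n%:R ->
    exists2 k, (k < K0)%N & energy k.+1 F n <= c * Q `^
      ((2 * (k.+1 * n))%:R - (size F).-1%:R / 2 + e * (size F).-1%:R).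
Proof.
move=> eps0 e0; pose K0 := (Num.truncn (1 / (2 * eps))).+2.
have [c c1 cP] := large_energy_bound K K0 e0; exists K0, c => // F n F0 n0.
set r := (size F).-1 => le_n.
have ex_k : exists k, (r <= 2 * (k.+1 * n))%N by exists r; clear -n0; nia.
pose k := ex_minn ex_k; have [kn min_k] : (r <= 2 * (k.+1 * n))%N /\
    forall j, (r <= 2 * (j.+1 * n))%N -> (k <= j)%N.
  by rewrite /k; case: ex_minnP.
have kn_lt : (0 < k)%N -> (2 * (k * n) < r)%N.
  case: (k) min_k => // j min_j _; rewrite ltnNge; apply/negP => /min_j.
  by rewrite ltnn.
(* If [k] reached [K0], then k > 1 / (2 eps) would give 2kn >= r, against minimality. *)
have kK0 : (k < K0)%N.
  rewrite ltnNge; apply/negP => K0k.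
  have : (2 * (k * n) < r)%N by apply: kn_lt; apply: leq_trans K0k.
  rewrite -(ltr_nat R) !natrM.
  have := truncnS_gt (1 / (2 * eps)); rewrite ltr_pdivrMr ?mulr_gt0 //.
  have : (Num.truncn (1 / (2 * eps))).+1%:R <= k%:R :> R by rewrite ler_nat; lia.
  have r0 : 0 <= r%:R :> R by [].
  move: (_.+1%:R) (k%:R) (n%:R) (r%:R) r0 le_n => t k' n' r' r0 le_n tk teps kn'.
  have k'0 : 0 <= k' by nra.
  have : 2 * (k' * (r' * eps)) < r' by apply: le_lt_trans kn'; rewrite ler_pM2l // ler_wpM2l.
  have h1 : 1 <= 2 * (k' * eps) by have := ler_wpM2r (ltW eps0) tk; lra.
  by have := ler_wpM2l r0 h1; lra.
exists k => //; have [k0|k0] := posnP k.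
  rewrite k0; apply: le_trans (trivial_energy_bound R n F0) _.
  rewrite -[leLHS]mul1r ler_pM ?powR_ge0 // ler_powR_Q // -/r mul1n.
  have er : 0 <= e * r%:R by rewrite mulr_ge0 // ltW.
  have le1 : r%:R <= 2 * n%:R :> R by rewrite -natrM ler_nat; move: kn; rewrite k0 mul1n.
  have r0 : 0 <= r%:R :> R by [].
  rewrite natrM; have [nr|/ltnW nr] := leqP n r.
    by move: nr; rewrite -subn_eq0 => /eqP->; lra.
  by rewrite natrB //; lra.
by apply: cP => //; apply: kn_lt.
Qed.

(** For n <= r the quadruple bound is used: if 3n <= r, the saving comes from 2n >= r/2 + 2 eps r;
    if 3n > r, it comes from n/2 >= r/8. For n > r the trivial bound saves r, which exceeds r/2 +
    r/8. The minimum of 2 eps and 1/8 is thus available in every case. *)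
Lemma energy_long (eps e : R) : 0 < eps -> 0 < e ->
  exists2 c : R, 1 <= c & forall F n, F != 0 -> (0 < n)%N ->
    (size F).-1%:R * (1 / 4 + eps) <= n%:R ->
    exists2 l, (l < 2)%N & energy l.+1 F n <= c * Q `^
      ((2 * (l.+1 * n))%:R - (size F).-1%:R / 2
       - Num.min (2 * eps) (1 / 8) * (size F).-1%:R + e * (size F).-1%:R).
Proof.
move=> eps0 e0; have [c c1 cP] := quadruple_energy_bound K e0.
exists c => // F n F0 n0; set r := (size F).-1 => le_n; set g := Num.min _ _.
have g1 : g <= 2 * eps by rewrite /g ge_min lexx.
have g2 : g <= 1 / 8 by rewrite /g ge_min lexx orbT.
have r0 : 0 <= r%:R :> R by [].
have er : 0 <= e * r%:R by rewrite mulr_ge0 // ltW.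
have gr1 : g * r%:R <= 2 * eps * r%:R by rewrite ler_wpM2r.
have gr2 : g * r%:R <= 1 / 8 * r%:R by rewrite ler_wpM2r.
have [n_le|n_gt] := leqP n r.
  exists 1%N => //; apply: le_trans (cP F n n0 n_le) _; rewrite ler_wpM2l ?(le_trans ler01) //.
  rewrite ler_powR_Q // lerD2r -/r !natrM.
  have [h|/ltnW h] := leqP (3 * n) r.
    by move: h; rewrite -subn_eq0 => /eqP->; lra.
  by rewrite natrB // natrM; lra.
exists 0%N => //; apply: le_trans (trivial_energy_bound R n F0) _.
rewrite -[leLHS]mul1r ler_pM ?powR_ge0 // ler_powR_Q // -/r mul1n.
by rewrite natrM natrB ?(ltnW n_gt) //; lra.
Qed.

Lemma normc_complex (z : R[i]) : `|z| = (ComplexField.Normc.normc z)%:C%C.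
Proof. by []. Qed.

Lemma normc_ge0 (z : R[i]) : 0 <= ComplexField.Normc.normc z.
Proof. by rewrite -lecR -normc_complex normr_ge0. Qed.

Lemma sup_norm_ge (I : finType) (w : I -> R[i]) i : ComplexField.Normc.normc (w i) <= sup_norm w.
Proof. by rewrite /sup_norm; apply: le_bigmax. Qed.

(** Modulo [F] the inverse of a product is the product of the inverses, so the sum is a bilinear
    form in the pairing at the inverse residues, and [bilinear_sum_bound] applies. *)
Lemma kloosterman_bilinear_bound (p : nat) (pcharK : p \in [pchar K]) F (a : {poly K})
    (m n k l : nat) (alpha : {poly_m K} -> R[i]) (beta : {poly_n K} -> R[i]) (A : R) :
  F != 0 -> coprimep a F -> sup_norm alpha <= A -> sup_norm beta <= A ->
  ComplexField.Normc.normc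
    (\sum_(x1 : {poly_m K} | coprimep x1 F) \sum_(x2 : {poly_n K} | coprimep x2 F)
       alpha x1 * beta x2
       * echar_mod R pcharK F (a * inv_mod F (polyn x1 * polyn x2))) ^+ (2 * k.+1 * l.+1)
  <= (A * A) ^+ (2 * k.+1 * l.+1) * Q ^+ (m * (2 * k * l.+1)) * Q ^+ (n * (2 * k.+1 * l))
     * (Q ^+ (size F).-1 * energy k.+1 F n * energy l.+1 F m).
Proof.
move=> F0 aF alphaA betaA.
have A0 : 0 <= A.
  by apply: le_trans alphaA; rewrite /sup_norm; apply: bigmax_ge_id.
set S := \sum_(x1 | _) _.
pose I := {x : {poly_n K} | x \in [pred x | coprimep (polyn x) F]}.
pose J := {x : {poly_m K} | x \in [pred x | coprimep (polyn x) F]}.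
have SE : S = \sum_(j : J) \sum_(i : I) alpha (val j) * beta (val i) *
    pairing R pcharK a (inv_res i) (inv_res j).
  rewrite /S (eq_bigl (fun x => x \in [pred x : {poly_m K} | coprimep (polyn x) F])) // big_sub.
  apply: eq_bigr => j _.
  rewrite (eq_bigl (fun x => x \in [pred x : {poly_n K} | coprimep (polyn x) F])) // big_sub.
  apply: eq_bigr => i _; congr (_ * _); rewrite /pairing !polyn_inv_res.
  apply: echar_mod_cong; rewrite -mulrBr dvdp_mull // [inv_mod _ _ * inv_mod _ _]mulrC.
  by apply: inv_mod_mul => //; [exact: (valP j) | exact: (valP i)].
have AC0 : 0 <= A%:C%C :> R[i] by rewrite lecR.
have normA (I' : finType) (w : I' -> R[i]) i : sup_norm w <= A -> `|w i| <= A%:C%C.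
  by move=> wA; rewrite normc_complex lecR (le_trans (sup_norm_ge _ _)).
have := bilinear_sum_bound (pairingDl R pcharK (F := F) a) (pairingDr R pcharK (F := F) a)
  (fun v v' => pairing_orth R pcharK v v' F0 aF)
  (P := fun i : I => beta (val i)) (Q := fun j : J => alpha (val j))
  (@inv_res K F n) (@inv_res K F m) k l AC0 AC0
  (fun i => normA _ _ _ betaA) (fun j => normA _ _ _ alphaA).
rewrite -SE normc_complex -rmorphXn; set B := (X in _ <= X).
have -> : B = ((A * A) ^+ (2 * k.+1 * l.+1) * #|{: J}|%:R ^+ (2 * k * l.+1)
    * #|{: I}|%:R ^+ (2 * k.+1 * l)
    * (#|{poly_(size F).-1 K}|%:R * energy k.+1 F n * energy l.+1 F m))%:C%C.
  by rewrite /B !rmorphM !rmorphXn !rmorphM !rmorph_nat.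
rewrite lecR => /le_trans; apply; rewrite {B}.
have cardU d : #|{: {x : {poly_d K} | x \in [pred x | coprimep (polyn x) F]}}|%:R <= Q ^+ d.
  by rewrite -natrX ler_nat -card_npoly card_sig max_card.
rewrite [Q ^+ (m * _)]exprM [Q ^+ (n * _)]exprM card_npoly [(_ ^ (size F).-1)%:R]natrX.
apply: ler_pM; rewrite ?mulr_ge0 ?exprn_ge0 ?mulr_ge0 //.
apply: ler_pM; rewrite ?mulr_ge0 ?exprn_ge0 ?mulr_ge0 //;
  last by rewrite lerXn2r ?nnegrE ?exprn_ge0 ?cardU.
by rewrite ler_wpM2l ?exprn_ge0 ?mulr_ge0 // lerXn2r ?nnegrE ?exprn_ge0 ?cardU.
Qed.

End MainEstimate.

Local Open Scope classical_set_scope.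

(** Beyond some N convergence gives 2 eta(r) <= d r; the finitely many earlier values are absorbed
    into [B]. *)
Lemma le_linear_of_cvg (R : realType) (eta : nat -> R) (d : R) : 0 < d ->
  (fun r : nat => eta r / r%:R) @ \oo --> (0 : R) ->
  exists2 B, 0 <= B & forall r, 2 * eta r <= d * r%:R + B.
Proof.
move=> d0 /cvgrPdist_lt/(_ (d / 2)); rewrite divr_gt0 // => /(_ isT)[N _ HN].
exists (\sum_(i < N.+1) `|2 * eta i|) => [|r]; first by apply: sumr_ge0.
have [rN|Nr] := leqP r N.
  have dr : 0 <= d * r%:R by rewrite mulr_ge0 // ltW.
  rewrite (bigD1 (Ordinal (rN : (r < N.+1)%N))) //=.
  set s := \sum_(i < _ | _) _; have s0 : 0 <= s by apply: sumr_ge0.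
  by have := ler_norm (2 * eta r); lra.
have r0 : 0 < r%:R :> R by rewrite ltr0n; apply: leq_ltn_trans Nr.
have := HN r (ltnW Nr); rewrite /= sub0r normrN => /(le_lt_trans (ler_norm _)).
rewrite ltr_pdivrMr // => le_eta.
set s := \sum_(i < _) _; have s0 : 0 <= s by apply: sumr_ge0.
lra.
Qed.

Theorem theorem2p1 (R : realType) (p : nat) (Fq : finFieldType)
  (pcharFq : p \in [pchar Fq]) (odd_q : odd #|Fq|) (eps : R) (eps_gt0 : 0 < eps) :
  exists2 delta : R, 0 < delta &
  forall eta : nat -> R, (fun r : nat => eta r / r%:R) @ \oo --> (0 : R) ->
  exists C : R,
  forall (r : nat) (a F : {poly Fq}), size F = r.+1 -> coprimep a F ->
  forall n m : nat, (0 < n)%N -> (0 < m)%N ->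
  r%:R * eps <= n%:R -> r%:R * (1 / 4 + eps) <= m%:R ->
  forall (alpha : {poly_m Fq} -> R[i]) (beta : {poly_n Fq} -> R[i]),
  sup_norm alpha < #|Fq|%:R `^ eta r -> sup_norm beta < #|Fq|%:R `^ eta r ->
  ComplexField.Normc.normc
    (\sum_(x1 : {poly_m Fq} | coprimep x1 F) \sum_(x2 : {poly_n Fq} | coprimep x2 F)
       alpha x1 * beta x2
       * echar_mod R pcharFq F (a * inv_mod F (polyn x1 * polyn x2)))
  <= C * #|Fq|%:R `^ (m%:R + n%:R - r%:R * delta).
Proof.
pose g := Num.min (2 * eps) (1 / 8).
have g0 : 0 < g by rewrite /g lt_min mulr_gt0 //=; lra.
have e0 : 0 < g / 4 by lra.
have [K0 [c1 c1_ge1 short]] := energy_short Fq eps_gt0 e0.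
have [c2 c2_ge1 long] := energy_long Fq eps_gt0 e0.
have K1_gt0 : 0 < 16 * K0.+1%:R :> R by rewrite mulr_gt0 // ltr0n.
(* As k + 1 <= K0 and l + 1 <= 2, the exponent D = 2(k + 1)(l + 1) is at most 4(K0 + 1), so that D
   delta <= g / 4. *)
pose delta := g / (16 * K0.+1%:R).
have delta0 : 0 < delta by rewrite divr_gt0.
exists delta => // eta eta_small.
have [B B0 etaB] := le_linear_of_cvg delta0 eta_small.
(* The constant depends on the function [eta] through [B], while [delta] was fixed before [eta]. *)
exists (c1 * c2 * #|Fq|%:R `^ B) => r a F sF aF n m n0 m0 le_n le_m alpha beta.
move=> /ltW alpha_le /ltW beta_le.
have F0 : F != 0 by rewrite -size_poly_gt0 sF.
have rE : (size F).-1 = r by rewrite sF.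
have [k kK0 Ek] := short F n F0 n0 (eq_rect _ (fun r => r%:R * eps <= n%:R) le_n _ (esym rE)).
have [l l2 El] := long F m F0 m0
  (eq_rect _ (fun r => r%:R * (1 / 4 + eps) <= m%:R) le_m _ (esym rE)).
have := kloosterman_bilinear_bound pcharFq k l F0 aF alpha_le beta_le.
move: (collisions_sum k.+1 _) (collisions_sum l.+1 _) Ek El => En Em Ek El.
set S := ComplexField.Normc.normc _; set D := (2 * k.+1 * l.+1)%N.
have S0 : 0 <= S by apply: normc_ge0.
have c1_ge0 : 0 <= c1 := le_trans ler01 c1_ge1.
have c2_ge0 : 0 <= c2 := le_trans ler01 c2_ge1.
have c12 : 1 <= c1 * c2 by rewrite mulr_ege1.
rewrite rE in Ek El *; set Q : R := #|Fq|%:R in Ek El * => leS.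
have Q0 : 0 <= Q by rewrite ltW // Q_gt0.
have D_gt0 : (0 < D)%N by [].
(* The estimate is compared after raising both sides to the power D. *)
rewrite -(@ler_pXn2r _ D) ?nnegrE ?mulr_ge0 ?powR_ge0 ?(le_trans ler01 c12) //.
apply: le_trans leS _.
set x := _ - _ + _ in Ek; set y := _ - _ + _ in El.
apply: le_trans (_ : (c1 * c2) * Q `^ ((eta r + eta r) * D%:R
    + (m * (2 * k * l.+1))%:R + (n * (2 * k.+1 * l))%:R + (r%:R + x + y)) <= _).
  have -> (x' y' : R) (M N : nat) : c1 * c2 * Q `^ ((eta r + eta r) * D%:R + M%:R + N%:R
      + (r%:R + x' + y')) = (Q `^ eta r * Q `^ eta r) ^+ D * Q ^+ M * Q ^+ N *
      (Q ^+ r * (c1 * Q `^ x') * (c2 * Q `^ y')).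
    rewrite -powR_QD powR_QX !powR_QD !powR_mulrn //.
    by move: (Q `^ _) => t; ring.
  rewrite ler_wpM2l ?mulr_ge0 ?exprn_ge0 ?mulr_ge0 ?powR_ge0 //.
  by rewrite ler_pM ?mulr_ge0 ?exprn_ge0 // ler_wpM2l ?exprn_ge0.
rewrite -[X in _ <= X ^+ D]mulrA -powR_QD exprMn powR_QX.
apply: ler_pM; rewrite ?powR_ge0 ?(le_trans ler01 c12) //.
  by rewrite -[leLHS]expr1 ler_weXn2l.
rewrite ler_powR_Q // /x /y -/g.
have eta_le := etaB r.
have r0 : 0 <= r%:R :> R by [].
have DK : D%:R * delta * r%:R <= g / 4 * r%:R.
  rewrite ler_wpM2r // /delta mulrA ler_pdivrMr //.
  have : D%:R <= 4 * K0.+1%:R :> R.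
    by rewrite -natrM ler_nat /D; move: kK0 l2; clear; nia.
  by move=> /(ler_wpM2r (ltW g0)); lra.
have etaD : 2 * eta r * D%:R <= (delta * r%:R + B) * D%:R by rewrite ler_wpM2r.
(* The factor q^r cancels the two savings of r/2. The further saving g r loses 2(g/4) r to divisor
   bounds and at most (g/4) r, up to D B, to the weights. The remaining (g/4) r covers D delta r. *)
by move: DK etaD; rewrite /D !natrM -[k.+1%:R]natr1 -[l.+1%:R]natr1 => DK etaD; lra.
Qed.
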